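(* Suppose that $W(x)$ is a $2\times2$ weight matrix and that $\mathcal D(W)$ is noncommutative. Then $\mathcal D(W)$ is full. In fact in this case $\mathcal F(W)$, the total ring of fractions of the center $\mathcal Z(W)$ of $\mathcal D(W)$, is a field and $\mathcal D(W)$ is a $\mathcal Z(W)$-order in $M_2(\mathcal F(W))$.
   Context: Differential operators act on the right: $M_N(\Omega[x])$ is the algebra of matrix differential operators $\mathfrak D=\sum_j\partial_x^jA_j(x)$ with $A_j\in M_N(\mathbb C[x])$, acting on matrix functions by $F\cdot\mathfrak D=\sum_jF^{(j)}A_j$, with product determined by $F\cdot(\mathfrak D\mathfrak E)=(F\cdot\mathfrak D)\cdot\mathfrak E$. An $N\times N$ weight matrix $W$ supported on an interval $(x_0,x_1)$ (possibly infinite) is a Hermitian matrix-valued function $W:\mathbb R\to M_N(\mathbb C)$, zero outside $(x_0,x_1)$, entrywise smooth and positive definite on $(x_0,x_1)$, with finite moments $\int x^mW(x)dx$ for all $m\ge0$. It defines $\langle P,Q\rangle_W=\int P(x)W(x)Q(x)^*dx$ for $P,Q\in M_N(\mathbb C[x])$. The sequence of monic orthogonal polynomials $P(x,n)$, $n\ge0$, of $W$ is the unique sequence in $M_N(\mathbb C[x])$ with $P(x,n)$ of degree $n$ and leading coefficient $I$, and $\langle P(x,n),P(x,m)\rangle_W=0$ for $m\ne n$. $\mathcal D(W)$ is the algebra of all $\mathfrak D\in M_N(\Omega[x])$ for which there are matrices $\Lambda(n)\in M_N(\mathbb C)$ with $P(x,n)\cdot\mathfrak D=\Lambda(n)P(x,n)$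 for all $n\geq0$. Fullness: let $\mathcal P_1(W),\dots,\mathcal P_r(W)$ be the minimal primes of $\mathcal Z(W)$ and $\mathcal F_i(W)$ the localization of $\mathcal Z(W)$ at $\mathcal P_i(W)$ (a field). There is an algebra isomorphism $\mathcal D(W)\otimes_{\mathcal Z(W)}\mathcal F(W)\cong\bigoplus_{i=1}^rM_{n_i}(\mathcal F_i(W))$ for uniquely determined positive integers $n_i$; $\mathcal D(W)$ is called full if $n_1+\dots+n_r=N$. The natural map $\mathcal D(W)\to\mathcal D(W)\otimes_{\mathcal Z(W)}\mathcal F(W)$ is injective, and ''order in $M_2(\mathcal F(W))$'' refers to $\mathcal D(W)$ viewed inside this localization, identified with $M_2(\mathcal F(W))$. *)

(* Defs.v *)
From HB Require Import structures.
From mathcomp Require Import all_boot all_order all_algebra ring_quotient ring.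
From mathcomp Require Import complex.
From mathcomp Require Import all_classical all_reals all_analysis.

Set Implicit Arguments.
Unset Strict Implicit.
Unset Printing Implicit Defensive.

Import Order.TTheory GRing.Theory Num.Theory.
Local Open Scope ring_scope.
Local Open Scope quotient_scope.
Local Open Scope complex_scope.
Local Open Scope sesquilinear_scope.

Section DiffOp.
Variables (K : numFieldType) (n : nat).
Local Notation M := 'M[{poly K}]_n.+1.
Implicit Types (F G : M) (D E : {poly M}).

Definition dermx F : M := map_mx (@deriv K) F.

(* A polynomial D stands for the operator \sum_j d^j D`_j whose coefficients
   are on the right. *)
Definition dact F D : M := \sum_(j < size D) iter j dermx F *m D`_j.

(* Leibniz rule: D d = \sum_j (d^j.+1 D`_j + d^j (D`_j)'). *)
Definition dop_derr D : {poly M} := D * 'X + map_poly dermx D.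

(* Acting by D and then by \sum_j d^j E`_j is acting by \sum_j (D d^j) E`_j;
   [dact_mul] and [dact_faithful] below show that this is the product
   determined by the action. *)
Definition dop_mul D E : {poly M} :=
  \sum_(j < size E) iter j dop_derr D * (E`_j)%:P.

Lemma dermxD F G : dermx (F + G) = dermx F + dermx G.
Proof. by apply/matrixP => i j; rewrite !mxE derivD. Qed.

Lemma dermx0 : dermx 0 = 0.
Proof. by apply/matrixP => i j; rewrite !mxE deriv0. Qed.

Lemma dermx_sum I r (P : pred I) (f : I -> M) :
  dermx (\sum_(i <- r | P i) f i) = \sum_(i <- r | P i) dermx (f i).
Proof. exact: (big_morph dermx dermxD dermx0). Qed.

Lemma dermxM F G : dermx (F *m G) = dermx F *m G + F *m dermx G.
Proof.
apply/matrixP => i j; rewrite !mxE raddf_sum -big_split /=.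
by apply: eq_bigr => k _; rewrite !mxE derivM.
Qed.

Lemma iter_dermxD k F G :
  iter k dermx (F + G) = iter k dermx F + iter k dermx G.
Proof. by elim: k => //= k ->; rewrite dermxD. Qed.

Lemma dactE m F D : (size D <= m)%N ->
  dact F D = \sum_(j < m) iter j dermx F *m D`_j.
Proof.
move=> Dm; rewrite /dact (big_ord_widen _ (fun j => iter j dermx F *m D`_j) Dm).
rewrite [RHS](bigID (fun j : 'I_m => (j < size D)%N)) /=.
rewrite [X in _ = _ + X]big1 ?addr0 // => j; rewrite -leqNgt => Dj.
by rewrite nth_default // mulmx0.
Qed.

Lemma dactDr F D E : dact F (D + E) = dact F D + dact F E.
Proof.
rewrite (dactE F (size_polyD D E)).
rewrite (dactE F (leq_maxl (size D) (size E))).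
rewrite (dactE F (leq_maxr (size D) (size E))) -big_split /=.
by apply: eq_bigr => j _; rewrite coefD mulmxDr.
Qed.

Lemma dactDl F G D : dact (F + G) D = dact F D + dact G D.
Proof.
rewrite /dact -big_split /=.
by apply: eq_bigr => j _; rewrite iter_dermxD mulmxDl.
Qed.

Lemma dact0r F : dact F 0 = 0.
Proof. by rewrite /dact size_poly0 big_ord0. Qed.

Lemma dact_sumr F I r (P : pred I) (f : I -> {poly M}) :
  dact F (\sum_(i <- r | P i) f i) = \sum_(i <- r | P i) dact F (f i).
Proof. exact: (big_morph (dact F) (dactDr F) (dact0r F)). Qed.

Lemma dact1 F : dact F 1 = F.
Proof. by rewrite /dact size_poly1 big_ord1 coef1 /= mulmx1. Qed.

Lemma dact_mulC F D (B : M) : dact F (D * B%:P) = dact F D *m B.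
Proof.
have le: (size (D * B%:P)%R <= size D)%N.
  by apply/leq_sizeP => j Dj; rewrite coefMC nth_default ?mul0r.
rewrite (dactE F le) /dact mulmx_suml; apply: eq_bigr => j _.
by rewrite coefMC mulmxA.
Qed.

Lemma dact_derr F D : dact F (dop_derr D) = dermx (dact F D).
Proof.
rewrite /dop_derr dactDr.
have sX : (size (D * 'X)%R <= (size D).+1)%N.
  by apply/leq_sizeP => -[|j] // Dj; rewrite coefMX /= nth_default.
rewrite (dactE F sX) big_ord_recl coefMX /= mulmx0 add0r.
have sd : (size (map_poly dermx D) <= size D)%N.
  by apply/leq_sizeP => j Dj; rewrite coef_map_id0 ?dermx0 //
    nth_default ?dermx0.
rewrite (dactE F sd) /dact dermx_sum -big_split /=; apply: eq_bigr => j _.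
by rewrite dermxM coefMX /= coef_map_id0 ?dermx0.
Qed.

Lemma dact_mul F D E : dact F (dop_mul D E) = dact (dact F D) E.
Proof.
rewrite /dop_mul dact_sumr [RHS]/dact; apply: eq_bigr => j _.
rewrite dact_mulC; congr (_ *m _).
by elim: (j : nat) => //= k IH; rewrite dact_derr IH.
Qed.

Lemma iter_dermx_scalar k (p : {poly K}) :
  iter k dermx p%:M = (p^`(k))%:M.
Proof.
elim: k => [|k IH]; first by rewrite derivn0.
by rewrite iterS IH derivnS; apply/matrixP => i j; rewrite !mxE derivMn.
Qed.

Lemma dact_faithful D : (forall F, dact F D = 0) -> D = 0.
Proof.
move=> D0; apply/polyP => k; rewrite coef0.
elim/ltn_ind: k => k IH.
have [kD|Dk] := ltnP k (size D); last by rewrite nth_default.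
have := D0 ('X^k)%:M; rewrite /dact (bigD1 (Ordinal kD)) //= big1 ?addr0.
  rewrite iter_dermx_scalar derivnXn subnn expr0 ffactnn -scalemx1 -scalemxAl.
  rewrite mul1mx => /matrixP e; apply/matrixP => i j.
  have := e i j; rewrite !mxE.
  rewrite mulr_natl -scaler_nat => /eqP.
  by rewrite scaler_eq0 pnatr_eq0 (gtn_eqF (fact_gt0 k)) => /eqP.
move=> j jk; have {}jk : (j : nat) != k.
  by apply: contra jk => /eqP jk; apply/eqP/val_inj.
case: (ltngtP j k) jk => // jk _; first by rewrite IH // mulmx0.
rewrite iter_dermx_scalar derivnXn ffact_small // mulr0n.
by rewrite raddf0 mul0mx.
Qed.

Lemma dact_ext D E : (forall F, dact F D = dact F E) -> D = E.
Proof.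
move=> DE; apply/eqP; rewrite -subr_eq0; apply/eqP/dact_faithful => F.
apply: (addIr (dact F E)); rewrite -dactDr subrK DE add0r //.
Qed.

Definition diffop : Type := {poly M}.
HB.instance Definition _ := GRing.Zmodule.on diffop.

Lemma dop_mulA : associative (dop_mul : diffop -> diffop -> diffop).
Proof. by move=> D E G; apply: dact_ext => F; rewrite !dact_mul. Qed.

Lemma dop_mul1l : left_id (1 : {poly M}) (dop_mul : diffop -> diffop -> diffop).
Proof. by move=> D; apply: dact_ext => F; rewrite dact_mul dact1. Qed.

Lemma dop_mul1r :
  right_id (1 : {poly M}) (dop_mul : diffop -> diffop -> diffop).
Proof. by move=> D; apply: dact_ext => F; rewrite dact_mul dact1. Qed.

Lemma dop_mulDl :
  left_distributive (dop_mul : diffop -> diffop -> diffop) +%R.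
Proof.
by move=> D E G; apply: dact_ext => F; rewrite dactDr !dact_mul dactDr dactDl.
Qed.

Lemma dop_mulDr :
  right_distributive (dop_mul : diffop -> diffop -> diffop) +%R.
Proof.
by move=> D E G; apply: dact_ext => F; rewrite dactDr !dact_mul dactDr.
Qed.

Lemma dop1_neq0 : (1 : {poly M}) != (0 : diffop).
Proof. exact: oner_neq0. Qed.

HB.instance Definition _ := GRing.Zmodule_isNzRing.Build diffop
  dop_mulA dop_mul1l dop_mul1r dop_mulDl dop_mulDr dop1_neq0.

Lemma dactM F (D E : diffop) : dact F (D * E) = dact (dact F D) E.
Proof. exact: dact_mul. Qed.

Lemma dermx_mulCl (c : 'M[K]_n.+1) F :
  dermx (map_mx polyC c *m F) = map_mx polyC c *m dermx F.
Proof.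
rewrite dermxM [X in X *m _](_ : _ = 0) ?mul0mx ?add0r //.
by apply/matrixP => i j; rewrite !mxE derivC.
Qed.

Lemma dact_mulCl (c : 'M[K]_n.+1) F D :
  dact (map_mx polyC c *m F) D = map_mx polyC c *m dact F D.
Proof.
rewrite /dact mulmx_sumr; apply: eq_bigr => j _; rewrite mulmxA.
by congr (_ *m _); elim: (j : nat) => //= k ->; rewrite dermx_mulCl.
Qed.

Lemma dactBr F D E : dact F (D - E) = dact F D - dact F E.
Proof. by apply: (addIr (dact F E)); rewrite -dactDr !subrK. Qed.
End DiffOp.

Section Center.
Variable A : nzRingType.

Definition ring_central : {pred A} :=
  fun z => `[< forall a : A, z * a = a * z >].

Lemma centralP (z : A) : reflect (forall a, z * a = a * z) (z \in ring_central).
Proof. exact: asboolP. Qed.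

Lemma central_subring_closed : subring_closed ring_central.
Proof.
split; first by apply/centralP => a; rewrite mul1r mulr1.
- move=> x y /centralP xc /centralP yc; apply/centralP => a.
  by rewrite mulrBl mulrBr xc yc.
- move=> x y /centralP xc /centralP yc; apply/centralP => a.
  by rewrite -mulrA yc mulrA xc mulrA.
Qed.

HB.instance Definition _ :=
  GRing.isSubringClosed.Build A ring_central central_subring_closed.

Record ring_center :=
  RingCenter { ring_center_val :> A; _ : ring_center_val \in ring_central }.
HB.instance Definition _ := [isSub for ring_center_val].
HB.instance Definition _ := [Choice of ring_center by <:].
HB.instance Definition _ := [SubChoice_isSubNzRing of ring_center by <:].

Lemma ring_center_mulC : commutative (@GRing.mul ring_center).
Proof. by move=> x y; apply/val_inj/(centralP _ (valP x)). Qed.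

HB.instance Definition _ :=
  GRing.PzRing_hasCommutativeMul.Build ring_center ring_center_mulC.

Lemma ring_center_comm (z : ring_center) (a : A) : val z * a = a * val z.
Proof. exact: (centralP _ (valP z)). Qed.
End Center.

Section Localization.
Variables (Z : comNzRingType) (S : mulrClosed Z).

(* The factor u in [frac_eq] is needed because S may contain zero divisors. *)

Record fracrep := FracRep { fnum : Z; fden : Z; fden_in : fden \in S }.
HB.instance Definition _ := gen_eqMixin fracrep.
HB.instance Definition _ := gen_choiceMixin fracrep.

Definition frac_eq (x y : fracrep) : bool :=
  `[< exists2 u, u \in S & u * (fnum x * fden y) = u * (fnum y * fden x) >].

Lemma frac_eq_refl : reflexive frac_eq.
Proof. by move=> x; apply/asboolP; exists 1 => //; exact: rpred1. Qed.

Lemma frac_eq_sym : symmetric frac_eq.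
Proof. by move=> x y; apply/asboolP/asboolP => -[u uS e]; exists u. Qed.

Lemma frac_eq_trans : transitive frac_eq.
Proof.
move=> y x z /asboolP[u uS e] /asboolP[v vS f]; apply/asboolP.
exists (u * v * fden y); first by rewrite !rpredM // fden_in.
transitivity (v * fden z * (u * (fnum x * fden y))); first by ring.
rewrite e; transitivity (u * fden x * (v * (fnum y * fden z))); first by ring.
by rewrite f; ring.
Qed.

Canonical frac_equiv := EquivRel frac_eq frac_eq_refl frac_eq_sym frac_eq_trans.

Definition loc : Type := {eq_quot frac_eq}.
HB.instance Definition _ := Choice.on loc.
HB.instance Definition _ := EqQuotient.on loc.

Lemma locP (x y : fracrep) :
  reflect (exists2 u, u \in S & u * (fnum x * fden y) = u * (fnum y * fden x))
          (\pi_loc x == \pi_loc y).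
Proof. by rewrite eqmodE; exact: asboolP. Qed.

Definition frac_opp x : fracrep := FracRep (- fnum x) (fden_in x).
Definition frac_add x y : fracrep :=
  FracRep (fnum x * fden y + fnum y * fden x) (rpredM (fden_in x) (fden_in y)).
Definition frac_mul x y : fracrep :=
  FracRep (fnum x * fnum y) (rpredM (fden_in x) (fden_in y)).

Lemma repr_pi (x : fracrep) : exists2 u, u \in S &
  u * (fnum (repr (\pi_loc x)) * fden x) =
  u * (fnum x * fden (repr (\pi_loc x))).
Proof. by apply/locP; rewrite reprK. Qed.

Lemma pi_locP (x y : fracrep) : fnum x * fden y = fnum y * fden x ->
  \pi_loc x = \pi_loc y.
Proof. by move=> e; apply/eqP/locP; exists 1; rewrite ?rpred1 ?e. Qed.

Definition to_loc := lift_embed loc (fun a => FracRep a (rpred1 S)).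
Canonical pi_to_loc_morph := PiEmbed to_loc.

Definition loc_opp := lift_op1 loc frac_opp.
Lemma pi_loc_opp : {morph \pi_loc : x / frac_opp x >-> loc_opp x}.
Proof.
move=> x; unlock loc_opp; apply/esym/eqP/locP.
by have [u uS e] := repr_pi x; exists u => //=; rewrite !mulNr !mulrN e.
Qed.
Canonical pi_loc_opp_morph := PiMorph1 pi_loc_opp.

Definition loc_add := lift_op2 loc frac_add.
Lemma pi_loc_add : {morph \pi_loc : x y / frac_add x y >-> loc_add x y}.
Proof.
move=> x y; unlock loc_add; apply/esym/eqP/locP.
have [u uS e] := repr_pi x; have [v vS f] := repr_pi y.
exists (u * v); rewrite ?rpredM //=.
move: (repr (\pi_loc x)) (repr (\pi_loc y)) e f => x' y' e f.
transitivity (u * (fnum x' * fden x) * v * fden y' * fden y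
  + v * (fnum y' * fden y) * u * fden x' * fden x); first by ring.
by rewrite e f; ring.
Qed.
Canonical pi_loc_add_morph := PiMorph2 pi_loc_add.

Definition loc_mul := lift_op2 loc frac_mul.
Lemma pi_loc_mul : {morph \pi_loc : x y / frac_mul x y >-> loc_mul x y}.
Proof.
move=> x y; unlock loc_mul; apply/esym/eqP/locP.
have [u uS e] := repr_pi x; have [v vS f] := repr_pi y.
exists (u * v); rewrite ?rpredM //=.
move: (repr (\pi_loc x)) (repr (\pi_loc y)) e f => x' y' e f.
transitivity ((u * (fnum x' * fden x)) * (v * (fnum y' * fden y)));
  first by ring.
by rewrite e f; ring.
Qed.
Canonical pi_loc_mul_morph := PiMorph2 pi_loc_mul.

Lemma loc_addA : associative loc_add.
Proof.
elim/quotW => x; elim/quotW => y; elim/quotW => z.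
by rewrite !piE; apply: pi_locP => /=; ring.
Qed.
Lemma loc_addC : commutative loc_add.
Proof.
by elim/quotW => x; elim/quotW => y; rewrite !piE; apply: pi_locP => /=; ring.
Qed.
Lemma loc_add0 : left_id (to_loc 0) loc_add.
Proof. by elim/quotW => x; rewrite !piE; apply: pi_locP => /=; ring. Qed.
Lemma loc_addN : left_inverse (to_loc 0) loc_opp loc_add.
Proof. by elim/quotW => x; rewrite !piE; apply: pi_locP => /=; ring. Qed.
HB.instance Definition _ :=
  GRing.isZmodule.Build loc loc_addA loc_addC loc_add0 loc_addN.

Lemma loc_mulA : associative loc_mul.
Proof.
elim/quotW => x; elim/quotW => y; elim/quotW => z.
by rewrite !piE; apply: pi_locP => /=; ring.
Qed.
Lemma loc_mulC : commutative loc_mul.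
Proof.
by elim/quotW => x; elim/quotW => y; rewrite !piE; apply: pi_locP => /=; ring.
Qed.
Lemma loc_mul1 : left_id (to_loc 1) loc_mul.
Proof. by elim/quotW => x; rewrite !piE; apply: pi_locP => /=; ring. Qed.
Lemma loc_mulDl : left_distributive loc_mul loc_add.
Proof.
elim/quotW => x; elim/quotW => y; elim/quotW => z.
by rewrite !piE; apply: pi_locP => /=; ring.
Qed.
HB.instance Definition _ :=
  GRing.Zmodule_isComPzRing.Build loc loc_mulA loc_mulC loc_mul1 loc_mulDl.

Lemma to_loc_is_zmod_morphism : zmod_morphism to_loc.
Proof.
move=> x y; rewrite -[RHS]/(loc_add (to_loc x) (loc_opp (to_loc y))) !piE.
by apply: pi_locP => /=; ring.
Qed.
Lemma to_loc_is_monoid_morphism : monoid_morphism to_loc.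
Proof.
split=> // x y; rewrite -[RHS]/(loc_mul _ _) !piE.
by apply: pi_locP => /=; ring.
Qed.
HB.instance Definition _ :=
  GRing.isZmodMorphism.Build Z loc to_loc to_loc_is_zmod_morphism.
HB.instance Definition _ :=
  GRing.isMonoidMorphism.Build Z loc to_loc to_loc_is_monoid_morphism.
End Localization.

Section Tensor.
Variables (A : nzRingType) (B : comPzRingType).
Variable (iota : {rmorphism ring_center A -> B}).

(* The tensor product of A and B over the center of A: formal sums of pairs,
   two of them being identified when no balanced map separates them. *)
Record balanced (V : zmodType) (b : A -> B -> V) : Prop := Balanced {
  balancedDl : forall x a a', b (a + a') x = b a x + b a' x;
  balancedDr : forall a x x', b a (x + x') = b a x + b a x';
  balancedZ : forall (z : ring_center A) a x, b (a * val z) x = b a (iota z * x)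
}.

Implicit Types s t : seq (A * B).

Definition tsum (V : zmodType) (b : A -> B -> V) s : V :=
  \sum_(p <- s) b p.1 p.2.

Definition tens_eq s t : bool :=
  `[< forall (V : zmodType) (b : A -> B -> V),
        balanced b -> tsum b s = tsum b t >].

Lemma tens_eq_refl : reflexive tens_eq.
Proof. by move=> s; apply/asboolP. Qed.

Lemma tens_eq_sym : symmetric tens_eq.
Proof.
by move=> s t; apply/asboolP/asboolP => st V b bb; apply/esym/st.
Qed.

Lemma tens_eq_trans : transitive tens_eq.
Proof.
move=> t s u /asboolP st /asboolP tu; apply/asboolP => V b bb.
by rewrite (st V b bb) (tu V b bb).
Qed.

Canonical tens_equiv := EquivRel tens_eq tens_eq_refl tens_eq_sym tens_eq_trans.

Definition ctensor : Type := {eq_quot tens_eq}.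
HB.instance Definition _ := Choice.on ctensor.
HB.instance Definition _ := EqQuotient.on ctensor.

Definition tens (a : A) (x : B) : ctensor := \pi_ctensor [:: (a, x)].

Lemma pi_tensP s t :
  (forall (V : zmodType) (b : A -> B -> V),
     balanced b -> tsum b s = tsum b t) <->
  \pi_ctensor s = \pi_ctensor t.
Proof.
split=> [st|/eqmodP/asboolP //].
by apply/eqmodP/asboolP.
Qed.

Lemma tsum_repr (V : zmodType) (b : A -> B -> V) s :
  balanced b -> tsum b (repr (\pi_ctensor s)) = tsum b s.
Proof. by move: V b; apply/pi_tensP; rewrite reprK. Qed.

Definition tens_opp s := [seq (- p.1, p.2) | p <- s].
Definition tens_mul s t := [seq (p.1 * q.1, p.2 * q.2) | p <- s, q <- t].

Section Sums.
Variables (V : zmodType) (b : A -> B -> V) (bb : balanced b).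

Lemma tsum_cat s t : tsum b (s ++ t) = tsum b s + tsum b t.
Proof. exact: big_cat. Qed.

Lemma balanced0l x : b 0 x = 0.
Proof. by apply: (addIr (b 0 x)); rewrite -(balancedDl bb) !add0r. Qed.

Lemma balancedNl a x : b (- a) x = - b a x.
Proof.
by apply: (addIr (b a x)); rewrite -(balancedDl bb) !addNr balanced0l.
Qed.

Lemma tsum_opp s : tsum b (tens_opp s) = - tsum b s.
Proof.
rewrite /tsum big_map -sumrN; apply: eq_bigr => p _ /=.
exact: balancedNl.
Qed.

Lemma tsum_mul s t : tsum b (tens_mul s t) =
  \sum_(p <- s) \sum_(q <- t) b (p.1 * q.1) (p.2 * q.2).
Proof. by rewrite /tsum /tens_mul big_allpairs_dep. Qed.

Lemma balanced_mulr t :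
  balanced (fun a x => \sum_(q <- t) b (a * q.1) (x * q.2)).
Proof.
split=> [x a a'|a x x'|z a x].
- by rewrite -big_split; apply: eq_bigr => q _; rewrite mulrDl (balancedDl bb).
- by rewrite -big_split; apply: eq_bigr => q _; rewrite mulrDl (balancedDr bb).
- apply: eq_bigr => q _.
  by rewrite -mulrA ring_center_comm mulrA (balancedZ bb) mulrA.
Qed.

Lemma balanced_mull s :
  balanced (fun a x => \sum_(p <- s) b (p.1 * a) (p.2 * x)).
Proof.
split=> [x a a'|a x x'|z a x].
- by rewrite -big_split; apply: eq_bigr => q _; rewrite mulrDr (balancedDl bb).
- by rewrite -big_split; apply: eq_bigr => q _; rewrite mulrDr (balancedDr bb).
- by apply: eq_bigr => q _; rewrite mulrA (balancedZ bb) mulrCA.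
Qed.
End Sums.

Definition ctens_zero : ctensor := \pi_ctensor [::].

Definition ctens_opp := lift_op1 ctensor tens_opp.
Lemma pi_ctens_opp : {morph \pi_ctensor : s / tens_opp s >-> ctens_opp s}.
Proof.
move=> s; unlock ctens_opp; apply/pi_tensP => V b bb.
by rewrite !tsum_opp // tsum_repr.
Qed.
Canonical pi_ctens_opp_morph := PiMorph1 pi_ctens_opp.

Definition ctens_add := lift_op2 ctensor (@cat (A * B)).
Lemma pi_ctens_add : {morph \pi_ctensor : s t / s ++ t >-> ctens_add s t}.
Proof.
move=> s t; unlock ctens_add; apply/pi_tensP => V b bb.
by rewrite !tsum_cat !tsum_repr.
Qed.
Canonical pi_ctens_add_morph := PiMorph2 pi_ctens_add.

Definition ctens_mul := lift_op2 ctensor tens_mul.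
Lemma pi_ctens_mul : {morph \pi_ctensor : s t / tens_mul s t >-> ctens_mul s t}.
Proof.
move=> s t; unlock ctens_mul; apply/pi_tensP => V b bb; rewrite !tsum_mul.
rewrite -[LHS](tsum_repr s (balanced_mulr bb t)) /tsum.
rewrite exchange_big [RHS]exchange_big /=.
by rewrite -[LHS](tsum_repr t (balanced_mull bb _)).
Qed.
Canonical pi_ctens_mul_morph := PiMorph2 pi_ctens_mul.

Lemma ctens_addA : associative ctens_add.
Proof.
by elim/quotW => s; elim/quotW => t; elim/quotW => u; rewrite !piE catA.
Qed.
Lemma ctens_addC : commutative ctens_add.
Proof.
elim/quotW => s; elim/quotW => t; rewrite !piE; apply/pi_tensP => V b bb.
by rewrite !tsum_cat addrC.
Qed.
Lemma ctens_add0 : left_id ctens_zero ctens_add.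
Proof. by elim/quotW => s; rewrite /ctens_zero !piE. Qed.
Lemma ctens_addN : left_inverse ctens_zero ctens_opp ctens_add.
Proof.
elim/quotW => s; rewrite /ctens_zero !piE; apply/pi_tensP => V b bb.
by rewrite tsum_cat tsum_opp // addNr /tsum big_nil.
Qed.
HB.instance Definition _ :=
  GRing.isZmodule.Build ctensor ctens_addA ctens_addC ctens_add0 ctens_addN.

Lemma ctens_mulA : associative ctens_mul.
Proof.
elim/quotW => s; elim/quotW => t; elim/quotW => u; rewrite !piE.
apply/pi_tensP => V b bb; rewrite !tsum_mul /tens_mul big_allpairs_dep.
apply: eq_bigr => p _; rewrite big_allpairs_dep; apply: eq_bigr => q _.
by apply: eq_bigr => r _; rewrite !mulrA.
Qed.
Lemma ctens_mul1l : left_id (tens 1 1) ctens_mul.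
Proof.
elim/quotW => s; rewrite /tens !piE; apply/pi_tensP => V b bb.
by rewrite tsum_mul big_seq1; apply: eq_bigr => p _; rewrite !mul1r.
Qed.
Lemma ctens_mul1r : right_id (tens 1 1) ctens_mul.
Proof.
elim/quotW => s; rewrite /tens !piE; apply/pi_tensP => V b bb.
by rewrite tsum_mul; apply: eq_bigr => p _; rewrite big_seq1 !mulr1.
Qed.
Lemma ctens_mulDl : left_distributive ctens_mul ctens_add.
Proof.
elim/quotW => s; elim/quotW => t; elim/quotW => u; rewrite !piE.
by apply/pi_tensP => V b bb; rewrite tsum_cat !tsum_mul big_cat.
Qed.
Lemma ctens_mulDr : right_distributive ctens_mul ctens_add.
Proof.
elim/quotW => s; elim/quotW => t; elim/quotW => u; rewrite !piE.
apply/pi_tensP => V b bb; rewrite tsum_cat !tsum_mul -big_split.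
by apply: eq_bigr => p _; rewrite big_cat.
Qed.
HB.instance Definition _ := GRing.Zmodule_isPzRing.Build ctensor
  ctens_mulA ctens_mul1l ctens_mul1r ctens_mulDl ctens_mulDr.
End Tensor.

Section Fullness.

Definition nonzerodiv (Z : comNzRingType) : {pred Z} :=
  fun z => `[< GRing.lreg z >].

Lemma nonzerodiv_mulr_closed (Z : comNzRingType) : mulr_closed (@nonzerodiv Z).
Proof.
split; first exact/asboolP/lreg1.
by move=> x y /asboolP xr /asboolP yr; apply/asboolP/lregM.
Qed.
HB.instance Definition _ (Z : comNzRingType) :=
  GRing.isMulClosed.Build Z (@nonzerodiv Z) (nonzerodiv_mulr_closed Z).

Definition prime_compl (Z : comNzRingType) (P : prime_idealr Z) : {pred Z} :=
  [predC P].

Lemma prime_compl_mulr_closed (Z : comNzRingType) (P : prime_idealr Z) :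
  mulr_closed (prime_compl P).
Proof.
split=> [|x y]; rewrite !inE; first by rewrite idealr1.
by move=> xP yP; rewrite prime_idealrM negb_or xP.
Qed.
HB.instance Definition _ (Z : comNzRingType) (P : prime_idealr Z) :=
  GRing.isMulClosed.Build Z (prime_compl P) (prime_compl_mulr_closed P).

Definition total_fractions (Z : comNzRingType) : comPzRingType :=
  loc (@nonzerodiv Z).

Definition loc_at (Z : comNzRingType) (P : prime_idealr Z) : comPzRingType :=
  loc (prime_compl P).

Definition minimal_prime (Z : comNzRingType) (P : prime_idealr Z) : Prop :=
  forall Q : prime_idealr Z, {subset Q <= P} -> Q =i P.

Definition is_field (F : comPzRingType) : Prop :=
  1 <> 0 :> F /\ forall x : F, x <> 0 -> exists y, x * y = 1.

(* The tensor product of A with the total ring of fractions of its center. *)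
Definition central_loc (A : nzRingType) : pzRingType :=
  ctensor (@to_loc (ring_center A) (@nonzerodiv (ring_center A))).

(* [P] lists the minimal primes of the center without repetition and [f] is
   the family of components of an isomorphism onto the product of the matrix
   rings; it is an isomorphism of algebras over the center, hence over its
   total ring of fractions. *)
Definition full (A : nzRingType) (N : nat) : Prop :=
  exists (r : nat) (P : 'I_r -> prime_idealr (ring_center A)) (k : 'I_r -> nat)
    (f : forall i, {rmorphism central_loc A -> 'M[loc_at (P i)]_(k i)}),
  [/\ (forall i j, P i =i P j -> i = j) /\
      (forall Q : prime_idealr (ring_center A),
         minimal_prime Q <-> exists i, Q =i P i),
      forall i, (0 < k i)%N,
      forall i (z : ring_center A),
        f i (tens _ (val z) 1) = (to_loc (prime_compl (P i)) z)%:M,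
      bijective (fun t i => f i t)
    & (\sum_i k i)%N = N].

(* [L] is an order over [Z], embedded in [F] by [iota], in the [F]-algebra of
   matrices: a unital subring which is finitely generated as a [Z]-module and
   spans the whole algebra over [F]. *)
Definition is_order (Z F : comPzRingType) (iota : {rmorphism Z -> F}) (n : nat)
    (L : set 'M[F]_n) : Prop :=
  [/\ L 1%:M,
      forall a b, L a -> L b -> L (a - b) /\ L (a *m b),
      exists (m : nat) (g : 'I_m -> 'M[F]_n), forall a,
        L a <-> exists c : 'I_m -> Z, a = \sum_j iota (c j) *: g j
    & forall a, exists (m : nat) (c : 'I_m -> F) (g : 'I_m -> 'M[F]_n),
        (forall j, L (g j)) /\ a = \sum_j c j *: g j].

End Fullness.

Section Weight.
Variables (R : realType) (n : nat).
Local Notation C := R[i].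
(* The matrix size is n.+1. *)
Implicit Types W : R -> 'M[C]_n.+1.
Implicit Types P Q : 'M[{poly C}]_n.+1.

Definition in_itv_oo (x0 x1 : \bar R) (x : R) : Prop :=
  (x0 < x%:E)%E /\ (x%:E < x1)%E.

Definition smooth_on (x0 x1 : \bar R) (f : R -> R) : Prop :=
  forall k x, in_itv_oo x0 x1 x -> derivable (derive1n k f) x 1.

Definition finite_moments (f : R -> R) : Prop :=
  forall m : nat, lebesgue_measure.-integrable setT
    (fun x : measurableTypeR R => (x ^+ m * f x)%:E).

Record weight_matrix (x0 x1 : \bar R) W : Prop := WeightMatrix {
  weight_itv : (x0 < x1)%E;
  weight_hermitian : forall x, W x \is hermsymmx;
  weight_out : forall x, ~ in_itv_oo x0 x1 x -> W x = 0;
  weight_smooth : forall i j,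
    smooth_on x0 x1 (fun x => complex.Re (W x i j)) /\
    smooth_on x0 x1 (fun x => complex.Im (W x i j));
  weight_posdef : forall x, in_itv_oo x0 x1 x ->
    forall u : 'rV[C]_n.+1, u != 0 -> 0 < (u *m W x *m u^t*) 0 0;
  weight_moments : forall i j,
    finite_moments (fun x => complex.Re (W x i j)) /\
    finite_moments (fun x => complex.Im (W x i j))
}.

Definition cintegral (f : R -> C) : C :=
  Rintegral lebesgue_measure setT (fun x => complex.Re (f x)) +i*
  Rintegral lebesgue_measure setT (fun x => complex.Im (f x)).

Definition evalmx P (x : R) : 'M[C]_n.+1 :=
  map_mx (fun p : {poly C} => p.[x%:C]) P.

Definition inner W P Q : 'M[C]_n.+1 :=
  \matrix_(i, j)
    cintegral (fun x => (evalmx P x *m W x *m (evalmx Q x)^t*) i j).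

Definition monic_degree (d : nat) P : Prop :=
  (forall i j, (size (P i j) <= d.+1)%N) /\ map_mx (coefp d) P = 1%:M.

Definition monic_orthogonal W (P : nat -> 'M[{poly C}]_n.+1) : Prop :=
  (forall d, monic_degree d (P d)) /\
  (forall d e, e != d -> inner W (P d) (P e) = 0).

(* For a weight matrix there is exactly one such sequence. *)
Definition monic_ops W : nat -> 'M[{poly C}]_n.+1 :=
  xget (fun=> 0) [set P | monic_orthogonal W P].

Definition bispectral W : {pred diffop C n} := fun D =>
  `[< exists Lambda : nat -> 'M[C]_n.+1, forall d,
        dact (monic_ops W d) D = map_mx polyC (Lambda d) *m monic_ops W d >].

Lemma bispectralP W (D : diffop C n) :
  reflect (exists Lambda : nat -> 'M[C]_n.+1, forall d,
      dact (monic_ops W d) D = map_mx polyC (Lambda d) *m monic_ops W d)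
    (D \in bispectral W).
Proof. exact: asboolP. Qed.

Lemma bispectral_subring_closed W : subring_closed (bispectral W).
Proof.
split.
- apply/bispectralP; exists (fun=> 1%:M) => d.
  by rewrite dact1 map_mx1 mul1mx.
- move=> D E /bispectralP[L LD] /bispectralP[L' LE]; apply/bispectralP.
  exists (fun d => L d - L' d) => d.
  by rewrite dactBr LD LE map_mxB mulmxBl.
- move=> D E /bispectralP[L LD] /bispectralP[L' LE]; apply/bispectralP.
  exists (fun d => L d *m L' d) => d.
  by rewrite dactM LD dact_mulCl LE map_mxM mulmxA.
Qed.
HB.instance Definition _ W := GRing.isSubringClosed.Build (diffop C n)
  (bispectral W) (bispectral_subring_closed W).

Record bispectral_algebra W := BispectralAlgebra {
  bispectral_val :> diffop C n; _ : bispectral_val \in bispectral W }.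
HB.instance Definition _ W := [isSub for @bispectral_val W].
HB.instance Definition _ W := [Choice of bispectral_algebra W by <:].
HB.instance Definition _ W :=
  [SubChoice_isSubNzRing of bispectral_algebra W by <:].

End Weight.

(* Main.v *)
From HB Require Import structures.
Require Import Defs.
From mathcomp Require Import all_boot all_order all_algebra ring_quotient.
From mathcomp Require Import polyXY zify ring complex.
From mathcomp Require Import all_classical all_reals all_analysis.

Set Implicit Arguments.
Unset Strict Implicit.
Unset Printing Implicit Defensive.

Import Order.TTheory GRing.Theory Num.Theory.
Local Open Scope ring_scope.

(** Differential operators turn into matrices over a polynomial ring.  An
    operator [D] of the algebra multiplies the monic orthogonal polynomial of
    degree [d] by a matrix on the left, and this matrix is the value at [d] of a
    matrix [symbol D] with entries in C[t]; the map [symbol] is an injective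
    ring morphism ([symbol_embedding]).  The algebra is also stable under
    adjunction: multiplication by [x] is symmetric, and a linear operator is a
    differential operator exactly when some iterated commutator with [x]
    vanishes, a condition which passes to the adjoint ([adjoint_operator]).
    Positivity of the inner product then gives [u * v * u != 0] for [u != 0] and
    [v] the adjoint of [u] ([bispectral_semiprime]).

    The rest is a statement on a noncommutative subalgebra A of M_2(K[t]) that
    contains the constants and is semiprime in this sense
    ([matrix_algebra_structure]).  Commutators in A are traceless, so their
    squares are scalar and hence central; conversely a central element is a
    scalar matrix, because the centralizer of a nonscalar matrix is commutative.
    Thus the center Z is a subring of K[t] and its fraction field F lies in
    K(t).  A commutator [u] with [u ^+ 2 = d != 0] anticommutes with every
    [w = u * x - x * u]; if also [w ^+ 2 = e != 0], then [u] and [w] span a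
    quaternion algebra.  It splits: by Luroth's theorem F is a rational function
    field K(s) ([luroth]), or K, and over such a field the conic
    x^2 = d y^2 + e z^2 has a point by Legendre's descent
    ([ternary_form_isotropic]).  So A contains a nonzero [n] with [n ^+ 2 = 0]
    ([exists_nilpotent]), and from [n] and some [v] with [n * v * n != 0] one
    writes down four matrix units, up to a denominator in Z
    ([exists_scaled_units]).  The entries of an element of A with respect to
    these units are fractions of Z, which identifies the localization of A with
    M_2(F) ([matrix_units_iso]); as Z is a domain, the zero ideal is its only
    minimal prime and fullness is the same isomorphism ([matrix_units_full]).

    Finally A is a finite Z-module ([finite_over_center]).  If Z consists of
    constants, then the four matrix units span A.  Otherwise Z contains a
    nonconstant [p], and M_2(K[t]) is a free module of finite rank over the
    principal ideal domain K[p], of which A is a submodule. *)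

(** * Ternary quadratic forms over K[X] *)

Section ClosedField.
Variable K : closedFieldType.
Implicit Types (a b f g p q s x y z : {poly K}) (h u v : {poly {poly K}}).

Lemma exists_sqrt (c : K) : exists r, r ^+ 2 = c.
Proof.
have [r] := @solve_monicpoly K 2 (fun i => if i == 0%N then c else 0) isT.
by rewrite !big_ord_recl big_ord0 /= !mul0r addr0 addr0 mulr1; exists r.
Qed.

(** A simultaneous square root of [a] modulo distinct linear factors: a multiple
    of [\prod_(t <- rs) ('X - t%:P)] corrects the value at one more point without
    changing the values at the points already treated. *)
Lemma exists_sqrt_mod_roots a (rs : seq K) : uniq rs ->
  exists c : {poly K}, (size c <= size rs)%N /\ forall r, r \in rs -> c.[r] ^+ 2 = a.[r].
Proof.
elim: rs => [|r rs IH] /=; first by exists 0; rewrite size_poly0.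
case/andP=> r_rs /IH[c [cs cr]]; have [d dr] := exists_sqrt a.[r].
set P := \prod_(t <- rs) ('X - t%:P).
have Pr : P.[r] != 0 by rewrite -[_ == 0]/(root P r) root_prod_XsubC.
exists (c + ((d - c.[r]) / P.[r]) *: P); split.
  rewrite (leq_trans (size_polyD _ _)) // geq_max (leq_trans cs) //.
  by rewrite (leq_trans (size_scale_leq _ _)) // size_prod_XsubC.
move=> t; rewrite inE hornerD hornerZ => /orP[/eqP->|trs].
  by rewrite divfK // addrC subrK.
have /rootP -> : root P t by rewrite root_prod_XsubC.
by rewrite mulr0 addr0 cr.
Qed.

Lemma not_uniq_perm (T : eqType) (rs : seq T) :
  ~~ uniq rs -> exists r rs', perm_eq rs (r :: r :: rs').
Proof.
elim: rs => //= r rs IH; rewrite negb_and negbK; case: (boolP (r \in rs)).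
  by move=> rrs _; exists r, (rem r rs); rewrite perm_cons perm_to_rem.
move=> _ /IH[t [rs' e]]; exists t, (r :: rs').
rewrite -(perm_cons r) in e; apply: (perm_trans e).
by rewrite (perm_catCA [:: r] [:: t; t] rs').
Qed.

(** Legendre's descent on [size a + size b].  Square factors are absorbed into
    the variables.  If [size a <= size b] and [b] has distinct roots, then [a] is
    a square modulo [b], all residue fields being [K], so that
    [c ^+ 2 - a = b' * b] with [b'] of smaller degree than [b]; the norm form
    [x ^+ 2 - a * y ^+ 2] being multiplicative, a solution for [b'] gives one
    for [b]. *)
Lemma ternary_form_isotropic a b : exists x y z,
  (x, y, z) != (0, 0, 0) /\ x ^+ 2 = a * y ^+ 2 + b * z ^+ 2.
Proof.
have [m] := ubnP (size a + size b); elim: m a b => // m IH a b.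
have sym (u v : {poly K}) : (exists x y z,
    (x, y, z) != (0, 0, 0) /\ x ^+ 2 = u * y ^+ 2 + v * z ^+ 2) ->
  exists x y z, (x, y, z) != (0, 0, 0) /\ x ^+ 2 = v * y ^+ 2 + u * z ^+ 2.
  case=> x [y [z [nz e]]]; exists x, z, y; split; last by rewrite addrC.
  by apply: contraNneq nz => -[-> -> ->].
have of_square (u v c : {poly K}) : c ^+ 2 = u -> exists x y z,
    (x, y, z) != (0, 0, 0) /\ x ^+ 2 = u * y ^+ 2 + v * z ^+ 2.
  move=> cu; exists c, 1, 0; split; first by rewrite !xpair_eqE oner_eq0 andbF.
  by rewrite cu expr1n mulr1 expr0n mulr0 addr0.
wlog ab : a b / (size a <= size b)%N => [WL|] sab.
  have [/WL|/ltnW ba] := leqP (size a) (size b); first exact.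
  by apply: sym; apply: WL => //; rewrite addnC.
have [b1|b1] := leqP (size b) 1.
  have [c cb] := exists_sqrt b`_0; apply/sym/(of_square _ _ c%:P).
  by rewrite [RHS](size1_polyC b1) -polyC_exp cb.
have b0 : b != 0 by rewrite -size_poly_gt0 ltnW.
have [rs brs] := closed_field_poly_normal b.
have sz_b : size b = (size rs).+1.
  by rewrite brs size_scale ?lead_coef_eq0 // size_prod_XsubC.
have [urs|/not_uniq_perm[r [rs' prs]]] := boolP (uniq rs); last first.
  have [b' bb'] : exists b', b = ('X - r%:P) ^+ 2 * b'.
    exists (lead_coef b *: \prod_(z <- rs') ('X - z%:P)).
    rewrite {1}brs (perm_big _ prs) !big_cons /=. by rewrite mulrA -expr2 scalerAr.
  have Xr : 'X - r%:P != 0 :> {poly K} by rewrite polyXsubC_eq0.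
  have b'0 : b' != 0 by apply: contraNneq b0 => b'0; rewrite bb' b'0 mulr0.
  have [|x [y [z [nz e']]]] := IH a b'.
    rewrite -ltnS (leq_trans _ sab) // ltnS ltn_add2l bb' mulrC.
    by rewrite size_Mmonic ?rpredX ?monicXsubC // size_exp_XsubC addn3 ltnS.
  exists (('X - r%:P) * x), (('X - r%:P) * y), z. split.
    apply: contraNneq nz => -[/eqP + /eqP + /eqP].
    rewrite !mulf_eq0 (negPf Xr) /= => /eqP-> /eqP-> /eqP->; exact: eqxx.
  by rewrite bb' exprMn e'; ring.
have [c [cs cr]] := exists_sqrt_mod_roots a urs.
have /dvdpP[b' bb'] : b %| c ^+ 2 - a.
  rewrite brs dvdpZl ?lead_coef_eq0 //; apply: uniq_roots_dvdp.
    by apply/allP => r /cr e; rewrite /root hornerD hornerN expr2 hornerM -expr2 e subrr.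
  by rewrite uniq_rootsE.
have [b'0|b'0] := eqVneq b' 0.
  apply: (of_square _ _ c); apply/eqP.
  by rewrite -subr_eq0 bb' b'0 mul0r.
have sb' : (size b' < size b)%N.
  have : (size (b' * b)%R <= maxn (size c + size c).-1 (size b))%N.
    rewrite -bb' (leq_trans (size_polyD _ _)) // size_polyN geq_max !leq_max.
    by rewrite ab orbT andbT expr2 size_polyMleq.
  rewrite size_mul // sz_b; move: cs b1; rewrite sz_b.
  by move: (size b') (size rs) (size c); clear; lia.
have [|x [y [z [nz e]]]] := IH a b'.
  by rewrite -ltnS (leq_trans _ sab) // ltnS ltn_add2l.
have [z0|z0] := eqVneq z 0.
  rewrite z0 in nz e; exists x, y, 0; split=> //.
  by rewrite e expr0n !mulr0.
exists (x * c + a * y), (x + c * y), (b' * z); split.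
  by apply: contraNneq z0 => -[_ _ /eqP]; rewrite mulf_eq0 (negPf b'0).
have c2 : c ^+ 2 = a + b' * b by rewrite -bb' addrC subrK.
(* The norms of [x + y sqrt a] and of [c + sqrt a] multiply. *)
have z2 : b' * z ^+ 2 = x ^+ 2 - a * y ^+ 2 by rewrite e addrAC subrr add0r.
have -> : b * (b' * z) ^+ 2 = b * b' * (b' * z ^+ 2) by ring.
have -> : (x * c + a * y) ^+ 2 =
  x ^+ 2 * c ^+ 2 + a ^+ 2 * y ^+ 2 + (x * c * a * y) *+ 2 by ring.
have -> : a * (x + c * y) ^+ 2 =
  a * x ^+ 2 + a * y ^+ 2 * c ^+ 2 + (x * c * a * y) *+ 2 by ring.
by rewrite z2 c2; ring.
Qed.
End ClosedField.

(** * Subrings of K[t] and Luroth's theorem *)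

Lemma size_sub_lead (R : nzRingType) (f g : {poly R}) : f != 0 ->
  size g = size f -> lead_coef g = lead_coef f -> (size (f - g)%R < size f)%N.
Proof.
move=> f0 sg lg; have sfg : (size (f - g)%R <= size f)%N.
  by rewrite (leq_trans (size_polyD _ _)) // size_polyN sg maxnn.
rewrite ltn_neqAle sfg andbT; apply: contraTneq f0 => e; rewrite negbK.
have : lead_coef (f - g) = 0.
  by rewrite lead_coefE e coefB -{2}sg -!lead_coefE lg subrr.
by move/eqP; rewrite lead_coef_eq0 -!size_poly_eq0 e.
Qed.

Section Luroth.
Variable K : closedFieldType.
Implicit Types (a b c f g p q s x y z : {poly K}) (h u v : {poly {poly K}}).

Lemma coefs_root_factor u (r : K) :
  (forall i, root u`_i r) -> exists v, u = ('X - r%:P) *: v.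
Proof.
move=> ur; exists (map_poly (fun c => c %/ ('X - r%:P)) u).
apply/polyP => i; rewrite coefZ coef_map_id0 ?div0p //.
by rewrite mulrC divpK // dvdp_XsubCl.
Qed.

(** Here [u] is a polynomial in [X] with coefficients in K[t], and [r] ranges over
    the points of the [t]-line: no irreducible element of K[t] divides [u]. *)
Definition primitive u := forall r : K, exists i, ~~ root u`_i r.

Lemma primitive_part u :
  u != 0 -> exists c v, [/\ c != 0, primitive v & u = c *: v].
Proof.
have [m] := ubnP (size (lead_coef u)); elim: m u => // m IH u su u0.
have [up|nup] := pselect (primitive u).
  by exists 1, u; split; rewrite ?oner_neq0 ?scale1r.
have /existsNP[r /forallNP ur] := nup.
have [i|v uv] := @coefs_root_factor u r; first exact/negPn/negP/ur.
have v0 : v != 0 by apply: contraNneq u0 => v0; rewrite uv v0 scaler0.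
have [|c [w [c0 wp e]]] := IH v _ v0.
  move: su; rewrite uv lead_coefZ mulrC size_Mmonic ?lead_coef_eq0 //.
    by rewrite size_XsubC addn2 !ltnS.
  exact: monicXsubC.
exists (('X - r%:P) * c), w; split=> //.
  by rewrite mulf_neq0 // polyXsubC_eq0.
by rewrite uv e scalerA.
Qed.

(** Gauss's lemma.  At a root [r] of [d] the product [v * h] specializes to zero
    and [h] does not, so ['X - r%:P] divides [v] and can be cancelled. *)
Lemma primitive_dvd d u h v : d != 0 -> primitive h -> d *: u = v * h ->
  exists w, u = w * h.
Proof.
have [m] := ubnP (size d); elim: m d v => // m IH d v sd d0 hp e.
have [d1|] := leqP (size d) 1.
  move: d0 e; rewrite (size1_polyC d1) polyC_eq0; set c := d`_0 => c0 e.
  exists ((c^-1)%:P *: v).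
  by rewrite -scalerAl -e scalerA -polyCM mulVf // scale1r.
rewrite ltn_neqAle eq_sym => /andP[/closed_rootP[r dr] _].
have /dvdpP[d' dd'] : 'X - r%:P %| d by rewrite dvdp_XsubCl.
have Xr : 'X - r%:P != 0 by rewrite polyXsubC_eq0.
have d'0 : d' != 0 by apply: contraNneq d0 => d'0; rewrite dd' d'0 mul0r.
have ev : map_poly (horner_eval r) v * map_poly (horner_eval r) h = 0.
  rewrite -rmorphM -e; apply/polyP => i; rewrite coef_map coefZ coef0 /=.
  by rewrite /horner_eval hornerM (rootP dr) mul0r.
have [i|v' vv'] := @coefs_root_factor v r.
  move/eqP: ev; rewrite mulf_eq0 => /orP[] /eqP/polyP p0.
    by have := p0 i; rewrite coef_map coef0 => /rootP.
  have [j /rootP[]] := hp r.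
  by have := p0 j; rewrite coef_map coef0.
apply: (IH d' v') => //.
  move: sd; rewrite dd' size_Mmonic ?monicXsubC // size_XsubC addn2 !ltnS.
  by [].
have := e; rewrite dd' vv' mulrC -scalerA -scalerAl -!mul_polyC.
by apply: mulfI; rewrite polyC_eq0.
Qed.

(** f(X) - f(t), the outer variable being X. *)
Definition difference f : {poly {poly K}} := f^:P - f%:P.

Lemma difference_root f : (difference f).['X] = 0.
Proof. by rewrite /difference hornerD hornerN hornerC -/(f \Po 'X) comp_polyXr subrr. Qed.

Lemma difference_neq0 f : (1 < size f)%N -> difference f != 0.
Proof.
move=> sf; apply/negP => /eqP/polyP/(_ (size f).-1)/eqP.
rewrite coefB coef_map coefC coef0 /= -lead_coefE.
have -> : ((size f).-1 == 0)%N = false.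
  by apply/negbTE; rewrite -lt0n ltn_predRL.
rewrite subr0 polyC_eq0 lead_coef_eq0 => /eqP f0.
by rewrite f0 size_poly0 in sf.
Qed.

Lemma size_difference f : (1 < size f)%N -> size (difference f) = size f.
Proof.
move=> f1; rewrite /difference size_polyDl size_map_polyC //.
by rewrite size_polyN size_polyC (leq_ltn_trans _ f1) // leq_b1.
Qed.

Lemma size_lead_coef_difference f : (1 < size f)%N -> size (lead_coef (difference f)) = 1%N.
Proof.
move=> f1; rewrite lead_coefDl.
  rewrite lead_coef_map_inj ?polyC0 //; last exact: polyC_inj.
  by rewrite size_polyC lead_coef_eq0 -size_poly_gt0 ltnW.
by rewrite size_map_polyC size_polyN size_polyC (leq_ltn_trans _ f1) // leq_b1.
Qed.

Variable S : subringClosed {poly K}.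
Hypothesis SC : forall r, r%:P \in S.

Definition fraction_of f := exists2 g, g \in S & g != 0 /\ g * f \in S.

Lemma fraction_of_S f : f \in S -> fraction_of f.
Proof.
by move=> fS; exists 1; rewrite ?mul1r ?oner_neq0 //; exact: rpred1.
Qed.

Lemma difference_polyOver g f : g \in S -> g * f \in S ->
  g *: difference f \is a polyOver S.
Proof.
move=> gS gfS; apply/polyOverP => i; rewrite coefZ coefB coef_map coefC mulrBr.
by apply: rpredB; [apply: rpredM => //; exact: SC | case: ifP; rewrite ?mulr0 ?rpred0].
Qed.

(** An equation of least degree for [t] with coefficients in [S]: up to a factor
    in [S], the minimal polynomial of [t] over the fraction field of [S]. *)
Lemma minimal_relation f : f \in S -> (1 < size f)%N ->
  exists h, [/\ h \is a polyOver S, h != 0, h.['X] = 0 &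
    forall u, u \is a polyOver S -> u.['X] = 0 -> (size u < size h)%N -> u = 0].
Proof.
move=> fS f1.
pose P n := `[< exists h, [/\ h \is a polyOver S, h != 0, h.['X] = 0 &
                              size h = n] >].
have exP : exists n, P n.
  exists (size (difference f)); apply/asboolP; exists (difference f); split=> //.
  - by rewrite -[difference f]scale1r difference_polyOver ?mul1r ?rpred1.
  - exact: difference_neq0.
  - exact: difference_root.
case: (ex_minnP exP) => n /asboolP[h [hS h0 hX <-]] hmin.
exists h; split=> // g gS gX gh; apply/eqP/negPn/negP => g0.
by move: gh; rewrite ltnNge hmin //; apply/asboolP; exists g.
Qed.

(** Pseudo-division by [h] stays within polynomials over [S], and a remainder
    vanishing at [t] is zero by minimality. *)
Lemma minimal_relation_dvd h (g : {poly {poly K}}) : h \is a polyOver S -> h != 0 -> h.['X] = 0 ->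
  (forall u, u \is a polyOver S -> u.['X] = 0 -> (size u < size h)%N -> u = 0) ->
  g \is a polyOver S -> g.['X] = 0 ->
  exists2 d, d != 0 & exists v, d *: g = v * h.
Proof.
move=> hS h0 hX hmin.
have [m] := ubnP (size g); elim: m g => // m IH g sg gS gX.
have [sgh|shg] := ltnP (size g) (size h).
  by exists 1; rewrite ?oner_neq0 //; exists 0; rewrite (hmin g) // scaler0 mul0r.
have g0 : g != 0.
  by rewrite -size_poly_gt0 (leq_trans _ shg) // size_poly_gt0.
set n := (size g - size h)%N.
set g' := lead_coef h *: g - lead_coef g *: ('X^n * h).
have lS u : u \is a polyOver S -> lead_coef u \in S.
  by move/polyOverP => uS; exact: uS.
have [||| d d0 [v e]] := IH g'.
- rewrite -ltnS (leq_trans _ sg) // ltnS.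
  have lh0 : lead_coef h != 0 by rewrite lead_coef_eq0.
  have lg0 : lead_coef g != 0 by rewrite lead_coef_eq0.
  rewrite -[ltnRHS](size_scale g lh0); apply: size_sub_lead.
  + by rewrite -size_poly_eq0 size_scale // size_poly_eq0.
  + by rewrite !size_scale // mulrC size_mulXn // subnK.
  + by rewrite !lead_coefZ mulrC lead_coefM lead_coefXn mul1r.
- by rewrite rpredB // polyOverZ ?lS // rpredM // rpredX // polyOverX.
- by rewrite hornerD hornerN !hornerZ hornerM gX hX !mulr0 subrr.
exists (d * lead_coef h); first by rewrite mulf_neq0 // lead_coef_eq0.
exists (v + d *: (lead_coef g *: 'X^n)).
by rewrite mulrDl -e scalerBr -!scalerAl subrK scalerA.
Qed.

(** The primitive part [h1] of a minimal equation [h] of [t] divides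
    [difference g] for every fraction [g] of [S]; taking for [g] an element of
    [S] shows that the leading coefficient of [h1] is a constant, whence all the
    coefficients of [h1] are fractions of [S].  The coefficient [s] of largest
    degree is the generator: in [difference s = w * h1], comparing the degrees in
    [t] shows that [w] is free of [t], and then it is a constant, so that
    [difference s] is [h1] up to a constant. *)
Lemma luroth_generator f : f \in S -> (1 < size f)%N ->
  exists2 s, fraction_of s & (1 < size s)%N /\
    forall g, fraction_of g -> exists v, difference g = v * difference s.
Proof.
move=> fS f1; have [h [hS h0 hX hmin]] := minimal_relation fS f1.
have [c [h1 [c0 h1p hc]]] := primitive_part h0.
have dvd g : fraction_of g -> exists v, difference g = v * h1.
  case=> d dS [d0 dgS].
  have rX : (d *: difference g).['X] = 0.
    by rewrite hornerZ difference_root mulr0.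
  have [e e0 [v ev]] := minimal_relation_dvd hS h0 hX hmin
    (difference_polyOver dS dgS) rX.
  apply: (@primitive_dvd (e * d) _ _ (c *: v) _ h1p); first exact: mulf_neq0.
  by rewrite -scalerA ev hc -scalerAl -scalerAr.
have [v fv] := dvd f (fraction_of_S fS).
have [l l0 lh1] : exists2 l : K, l != 0 & lead_coef h1 = l%:P.
  have := size_lead_coef_difference f1; rewrite fv lead_coefM => /eqP.
  rewrite size_mul_eq1 => /andP[_ /size_poly1P[l l0 ->]].
  by exists l.
have cS : c \in S.
  have : lead_coef h \in S by apply: polyOverP.
  rewrite hc lead_coefZ lh1 => /(rpredM (SC l^-1)).
  by rewrite mulrCA -polyCM mulVf // mulr1.
have coef_frac i : fraction_of h1`_i.
  by exists c => //; split=> //; have /polyOverP/(_ i) := hS; rewrite hc coefZ.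
have [i hi] : exists i, forall j, (size (h1`_j)%R <= size (h1`_i)%R)%N.
  have exP : exists n, `[< exists i, size h1`_i = n >].
    by exists (size h1`_0); apply/asboolP; exists 0%N.
  have [|n /asboolP[i <-] imax] := @ex_maxnP _ (sizeY h1) exP.
    by move=> n /asboolP[i <-]; exact: max_size_coefXY.
  by exists i => j; apply: imax; apply/asboolP; exists j.
set s := h1`_i in hi.
have s1 : (1 < size s)%N.
  rewrite ltnNge; apply/negP => s1.
  have h1E : h1 = (map_poly (fun a : {poly K} => a`_0) h1)^:P.
    apply/polyP => j; rewrite coef_map coef_map_id0 ?coef0 //=.
    by rewrite -size1_polyC // (leq_trans (hi j)).
  move/eqP: hX; rewrite hc hornerZ mulf_eq0 (negPf c0) /= h1E.
  rewrite -/(_ \Po 'X) comp_polyXr => /eqP h10.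
  by move: h0; rewrite hc h1E h10 map_poly0 scaler0 eqxx.
have [w sw] := dvd s (coef_frac i).
(* Exchanging the two variables compares degrees in [t]. *)
have [e e0 we] : exists2 e : K, e != 0 & w = e%:P%:P.
  have := congr1 (@swapXY K) sw; rewrite rmorphM rmorphB /=.
  rewrite swapXY_polyC swapXY_map_polyC => sw'.
  have sh1 : (size s <= size (swapXY h1))%N.
    by rewrite -sizeYE max_size_coefXY.
  have sw'N : difference s = - swapXY w * swapXY h1.
    by rewrite mulNr -sw' opprB.
  have d0 := difference_neq0 s1.
  have w0 : swapXY w != 0.
    by apply: contraNneq d0 => w0; rewrite sw'N w0 oppr0 mul0r.
  have h10 : swapXY h1 != 0.
    by apply: contraNneq d0 => h10; rewrite sw'N h10 mulr0.
  have w1 : (size (swapXY w) <= 1)%N.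
    have := congr1 (fun u : {poly {poly K}} => size u) sw'N.
    rewrite size_mul ?oppr_eq0 // size_polyN size_difference //.
    move: sh1 s1; move: (size s) (size (swapXY w)) (size (swapXY h1)).
    by move=> a b d; lia.
  have := size_lead_coef_difference s1; rewrite sw'N lead_coefM => /eqP.
  rewrite size_mul_eq1 => /andP[/size_poly1P[e e0 eE] _].
  exists (- e); first by rewrite oppr_eq0.
  rewrite -[w]swapXYK (size1_polyC w1) swapXY_polyC.
  have -> : (swapXY w)`_0 = (- e)%:P.
    have := eE; rewrite lead_coefN => /eqP; rewrite eqr_oppLR -polyCN => /eqP <-.
    by rewrite {2}(size1_polyC w1) lead_coefC.
  by rewrite map_polyC.
exists s; first exact: coef_frac; split=> // g /dvd[v' gv].
exists (v' * (e^-1)%:P%:P); rewrite gv sw we -mulrA; congr (_ * _).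
by rewrite mulrA -!polyCM mulVf // mul1r.
Qed.

(** Setting [t = 0] in [luroth_generator], [s - s.[0]] divides [f - f.[0]]; the
    quotient is again a polynomial which is a fraction of [S], of smaller degree
    than [f].  The statement is thus proved by induction for all such
    fractions. *)
Lemma luroth : exists2 s, fraction_of s & forall f, f \in S -> exists q, f = q \Po s.
Proof.
have [[f [fS f1]]|noS] := pselect (exists f, f \in S /\ (1 < size f)%N); last first.
  exists 0; first exact/fraction_of_S/rpred0.
  move=> f fS; exists f; have [f1|f1] := leqP (size f) 1.
    by rewrite (size1_polyC f1) comp_polyC.
  by case: noS; exists f.
have [s sf [s1 sdvd]] := luroth_generator fS f1; exists s => //.
suff H g : fraction_of g -> exists q, g = q \Po s.
  by move=> g /fraction_of_S/H.
have [m] := ubnP (size g); elim: m g => // m IH g sg gf.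
have [g1|g1] := leqP (size g) 1.
  by exists g; rewrite (size1_polyC g1) comp_polyC.
have at0 p : map_poly (horner_eval 0) (difference p) = p - (p.[0])%:P.
  rewrite rmorphB /= -map_poly_comp map_poly_id ?map_polyC //= => x _.
  by rewrite /horner_eval hornerC.
have [v gv] := sdvd _ gf; set g' := map_poly (horner_eval 0) v.
have e : g - (g.[0])%:P = g' * (s - (s.[0])%:P).
  by rewrite -!at0 gv rmorphM.
have szB p : (1 < size p)%N -> size (p - (p.[0])%:P) = size p.
  by move=> p1; rewrite size_polyDl // size_polyN size_polyC (leq_ltn_trans _ p1) // leq_b1.
have s0 : s - (s.[0])%:P != 0 by rewrite -size_poly_gt0 szB // ltnW.
have g'0 : g' != 0.
  apply/eqP => g'0; move: (g1); rewrite -(szB g g1) e g'0 mul0r.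
  by rewrite size_poly0.
have [] := IH g'.
- move: (szB g g1); rewrite e size_mul // szB // => szg; move: sg s1 szg.
  by move: (size g) (size g') (size s) => i j k; lia.
- have [a aS [a0 aS']] := gf; have [b bS [b0 bS']] := sf.
  have dS : (b * s - b * (s.[0])%:P) * a \in S.
    by rewrite rpredM // rpredB // rpredM // SC.
  exists ((b * s - b * (s.[0])%:P) * a) => //; split.
    by rewrite -mulrBr !mulf_neq0.
  have -> : (b * s - b * (s.[0])%:P) * a * g' = b * (a * g - a * (g.[0])%:P).
    by rewrite -!mulrBr e; ring.
  by rewrite rpredM // rpredB // rpredM // SC.
move=> q gq; exists ((q * ('X - (s.[0])%:P)) + (g.[0])%:P).
by rewrite comp_polyD comp_polyM comp_polyB comp_polyX !comp_polyC -gq -e subrK.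
Qed.

Lemma clear_denominators g s q n : g \in S -> g * s \in S -> (size q <= n)%N ->
  g ^+ n * (q \Po s) \in S.
Proof.
move=> gS gsS qn; rewrite comp_polyE mulr_sumr rpred_sum // => i _.
have in_ : (i <= n)%N by rewrite (leq_trans _ qn) // ltnW.
rewrite -(subnK in_) exprD -mul_polyC mulrCA -mulrA -exprMn.
by rewrite rpredM ?SC // rpredM ?rpredX.
Qed.

(** Tsen's theorem for ternary forms [<1, - a, - b>] over the fraction field of
    [S], obtained from the rational function field by clearing denominators. *)
Lemma ternary_form_isotropic_in a b : a \in S -> b \in S -> exists x y z,
  [/\ x \in S, y \in S & z \in S] /\
  ((x, y, z) != (0, 0, 0) /\ x ^+ 2 = a * y ^+ 2 + b * z ^+ 2).
Proof.
move=> aS bS; have [s [g gS [g0 gsS]] sP] := luroth.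
have [s1|s1] := leqP (size s) 1.
  have [q aq] := sP _ aS; have [c ce] := exists_sqrt q.[s`_0].
  exists c%:P, 1, 0; split; first by split; rewrite ?SC ?rpred1 ?rpred0.
  split; first by rewrite !xpair_eqE oner_eq0 andbF.
  rewrite expr1n mulr1 expr0n mulr0 addr0 -polyC_exp ce.
  by rewrite aq {2}(size1_polyC s1) comp_polyCr.
have [[a1 aE] [b1 bE]] := (sP _ aS, sP _ bS).
have [x [y [z [nz e]]]] := ternary_form_isotropic a1 b1.
pose n := (size x + size y + size z)%N.
have S_n q : (size q <= n)%N -> g ^+ n * (q \Po s) \in S.
  exact: clear_denominators.
exists (g ^+ n * (x \Po s)), (g ^+ n * (y \Po s)), (g ^+ n * (z \Po s)).
split; first by split; apply: S_n; rewrite /n; lia.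
have gn0 : g ^+ n != 0 by rewrite expf_neq0.
split; last first.
  have : (x \Po s) ^+ 2 = a * (y \Po s) ^+ 2 + b * (z \Po s) ^+ 2.
    by rewrite -!rmorphXn /= e comp_polyD !comp_polyM -aE -bE.
  by rewrite !exprMn => ->; ring.
apply: contraNneq nz => -[/eqP + /eqP + /eqP].
by rewrite !mulf_eq0 (negPf gn0) /= !comp_poly_eq0 // => /eqP-> /eqP-> /eqP->.
Qed.

End Luroth.

(** * Matrix units over the center *)

Section TensorFacts.
Local Open Scope quotient_scope.
Local Open Scope classical_set_scope.
Variables (A : nzRingType) (B : comPzRingType).
Variable (iota : {rmorphism ring_center A -> B}).

Lemma tensDr a x y : tens iota a (x + y) = tens iota a x + tens iota a y.
Proof.
rewrite -[RHS]/(ctens_add _ _) /tens !piE; apply/pi_tensP => V b bb.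
by rewrite tsum_cat /tsum !big_seq1 (balancedDr bb).
Qed.

Lemma tensDl a b x : tens iota (a + b) x = tens iota a x + tens iota b x.
Proof.
rewrite -[RHS]/(ctens_add _ _) /tens !piE; apply/pi_tensP => V f ff.
by rewrite tsum_cat /tsum !big_seq1 (balancedDl ff).
Qed.

Lemma tensZ a z x : tens iota (a * val z) x = tens iota a (iota z * x).
Proof.
by apply/pi_tensP => V b bb; rewrite /tsum !big_seq1 (balancedZ bb).
Qed.

Lemma tens0r a : tens iota a 0 = 0.
Proof. by apply: (addrI (tens iota a 0)); rewrite -tensDr !addr0. Qed.

Lemma tens0l x : tens iota 0 x = 0.
Proof. by apply: (addrI (tens iota 0 x)); rewrite -tensDl !addr0. Qed.

Lemma tens_suml I (s : seq I) (a : I -> A) x :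
  tens iota (\sum_(i <- s) a i) x = \sum_(i <- s) tens iota (a i) x.
Proof.
exact: (big_morph (fun a => tens iota a x) (fun a b => tensDl a b x) (tens0l x)).
Qed.

Lemma ctensor_ind (P : ctensor iota -> Prop) : P 0 ->
  (forall a x t, P t -> P (tens iota a x + t)) -> forall t, P t.
Proof.
move=> P0 PD; elim/quotW; elim=> [|[a x] s IH]; first exact: P0.
have := PD a x _ IH; rewrite -[X in P X -> _]/(ctens_add _ _) /tens.
by rewrite !piE.
Qed.
End TensorFacts.

Section TensorLift.
Local Open Scope quotient_scope.
Local Open Scope classical_set_scope.
Variables (A : nzRingType) (B : comPzRingType) (n : nat).
Variable (iota : {rmorphism ring_center A -> B}).
Variable (psi : {rmorphism A -> 'M[B]_n}).
Hypothesis psiZ : forall z : ring_center A, psi (val z) = (iota z)%:M.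

Lemma lift_balanced : balanced iota (fun a x => x *: psi a).
Proof.
split=> [x a a'|a x x'|z a x]; first by rewrite rmorphD scalerDr.
  by rewrite scalerDl.
by rewrite rmorphM psiZ -mulmxE mul_mx_scalar scalerA mulrC.
Qed.

Definition tens_lift (t : ctensor iota) : 'M[B]_n :=
  tsum (fun a x => x *: psi a) (repr t).

Lemma tens_liftE s :
  tens_lift (\pi_(ctensor iota) s) = tsum (fun a x => x *: psi a) s.
Proof. exact: tsum_repr lift_balanced. Qed.

Lemma tens_lift_tens a x : tens_lift (tens iota a x) = x *: psi a.
Proof. by rewrite tens_liftE /tsum big_seq1. Qed.

Lemma tens_lift_zmod_morphism : zmod_morphism tens_lift.
Proof.
elim/quotW => s; elim/quotW => t.
rewrite -[X in tens_lift X = _]/(ctens_add _ (ctens_opp _)) !piE !tens_liftE.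
by rewrite tsum_cat (tsum_opp lift_balanced).
Qed.

Lemma tens_lift_monoid_morphism : monoid_morphism tens_lift.
Proof.
split; first by rewrite [1]/(tens _ 1 1) tens_lift_tens rmorph1 scale1r.
elim/quotW => s; elim/quotW => t.
rewrite -[X in tens_lift X = _]/(ctens_mul _ _) !piE !tens_liftE tsum_mul.
rewrite /tsum big_distrl; apply: eq_bigr => p _; rewrite big_distrr.
apply: eq_bigr => q _ /=; rewrite rmorphM -!mulmxE.
by rewrite -scalemxAl -scalemxAr scalerA.
Qed.

HB.instance Definition _ := GRing.isZmodMorphism.Build (ctensor iota) 'M[B]_n
  tens_lift tens_lift_zmod_morphism.
HB.instance Definition _ := GRing.isMonoidMorphism.Build (ctensor iota) 'M[B]_n
  tens_lift tens_lift_monoid_morphism.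

Lemma tensor_extension : exists phi : {rmorphism ctensor iota -> 'M[B]_n},
  forall a x, phi (tens iota a x) = x *: psi a.
Proof. by exists tens_lift; exact: tens_lift_tens. Qed.
End TensorLift.

Lemma zero_prime_ideal (Z : comNzRingType) :
  (forall x y : Z, x * y = 0 -> x = 0 \/ y = 0) ->
  exists P : prime_idealr Z, P =i pred1 0.
Proof.
move=> dom.
have zc : zmod_closed (pred1 (0 : Z)).
  by split=> [|x y /eqP-> /eqP->]; rewrite inE ?subr0.
have pc : 1 \notin pred1 (0 : Z) /\
    forall a, {in pred1 (0 : Z), forall u, a * u \in pred1 (0 : Z)}.
  split; first by rewrite inE oner_eq0.
  by move=> a x; rewrite !inE => /eqP->; rewrite mulr0.
have prc : forall u v : Z, u * v \in pred1 0 ->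
    (u \in pred1 0) || (v \in pred1 0).
  by move=> x y; rewrite !inE => /eqP/dom[]->; rewrite eqxx ?orbT.
pose P : prime_idealr Z := HB.pack (pred1 (0 : Z) : Z -> bool)
  (GRing.isZmodClosed.Build Z _ zc) (isProperIdeal.Build Z _ pc)
  (isPrimeIdealrClosed.Build Z _ prc).
by exists P.
Qed.

(** The localization at the nonzero divisors and the localization at the zero
    ideal use different predicates; by this lemma they are equal structures over
    a domain. *)
Lemma mulrClosed_eq (Z : comNzRingType) (S S' : mulrClosed Z) : S =i S' -> S = S'.
Proof.
case: S S' => [s [m2 m1]] [s' [m2' m1']] e.
have es : s = s' by apply/funext => x; exact: (e x).
subst s'; clear e; congr (GRing.MulClosed.Pack (GRing.MulClosed.Class _ _)).
  by case: m2 m2' => p [q]; congr (GRing.isMul2Closed.Axioms_ _); exact: Prop_irrelevance.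
by case: m1 m1' => p [q]; congr (GRing.isMul1Closed.Axioms_ _); exact: Prop_irrelevance.
Qed.

Lemma loc_eq_iso (Z : comNzRingType) (S S' : mulrClosed Z) : S =i S' ->
  exists2 g : {rmorphism loc S -> loc S'}, bijective g &
    forall z, g (to_loc S z) = to_loc S' z.
Proof.
move/mulrClosed_eq => <-.
by exists (GRing.RMorphism.clone _ _ (@idfun (loc S)) _); first by exists idfun.
Qed.

(** Matrix units with a common denominator: [E i j] stands for [sg] times a matrix
    unit, where [sg] is a nonzero central element.  For an element [a] with entries
    [a_ij] in these units, the central element [\sum_k E k i * a * E j k] is
    [sg ^+ 2 * a_ij], so that entries are read off without inverting [sg]. *)
Section MatrixUnits.
Local Open Scope quotient_scope.
Local Open Scope classical_set_scope.
Variables (A : nzRingType) (n : nat) (E : 'I_n -> 'I_n -> A).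
Local Notation Z := (ring_center A).
Variable sg : Z.
Hypothesis torsionfree : forall (z : Z) (a : A), val z * a = 0 -> z = 0 \/ a = 0.
Hypothesis sg0 : sg != 0.
Hypothesis unitsM :
  forall i j k l, E i j * E k l = (val sg * E i l) *+ (j == k).
Hypothesis units_sum : \sum_i E i i = val sg.
Hypothesis entry_central :
  forall a i j, \sum_k E k i * a * E j k \in @ring_central A.

Definition entry a i j : Z := RingCenter (entry_central a i j).

Lemma center_domain (x y : Z) : x * y = 0 -> x = 0 \/ y = 0.
Proof.
move=> /(congr1 val); rewrite rmorphM => /torsionfree[]; first by left.
by move=> y0; right; apply: val_inj.
Qed.

Lemma nonzerodivE : @nonzerodiv Z =i predC1 0.
Proof.
move=> z; rewrite !inE; apply/asboolP/idP => [zr|/eqP z0 x y].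
  apply/eqP => z0; have := zr 1 0; rewrite z0 !mul0r => /(_ erefl)/eqP.
  by rewrite oner_eq0.
move=> /eqP; rewrite -subr_eq0 -mulrBr => /eqP/center_domain[//|/eqP].
by rewrite subr_eq0 => /eqP.
Qed.

Local Notation F := (total_fractions Z).
Local Notation iota := (@to_loc Z (@nonzerodiv Z)).

Lemma iota_inj : injective iota.
Proof.
move=> x y; unlock to_loc => /eqP/locP[u]; rewrite nonzerodivE inE => u0 /=.
rewrite !mulr1 => /eqP; rewrite -subr_eq0 -mulrBr => /eqP/center_domain[] /eqP.
  by rewrite (negPf u0).
by rewrite subr_eq0 => /eqP.
Qed.

Lemma fraction_inv z : z != 0 -> exists x : F, iota z * x = 1.
Proof.
move=> z0; have zS : z \in @nonzerodiv Z by rewrite nonzerodivE inE.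
exists (\pi_(loc (@nonzerodiv Z)) (FracRep 1 zS)).
rewrite -[LHS]/(loc_mul _ _) -[RHS]/(to_loc _ 1) !piE.
by apply: pi_locP => /=; ring.
Qed.

Lemma fractions_field : is_field F.
Proof.
split; first by rewrite -(rmorph1 iota) -(rmorph0 iota) => /iota_inj/eqP; rewrite oner_eq0.
elim/quotW => -[z w wS] z0.
have zn0 : z != 0.
  apply/eqP => z00; apply: z0; rewrite -(rmorph0 iota) /= !piE.
  by apply: pi_locP => /=; rewrite z00 !mul0r.
have [x zx] := fraction_inv zn0; exists (x * iota w); rewrite mulrCA.
rewrite -[RHS]zx; rewrite [iota z * _]mulrC; congr (_ * _).
rewrite -[LHS]/(loc_mul _ _) !piE.
by apply: pi_locP => /=; ring.
Qed.

Lemma centralCA (z : Z) (a b : A) : a * (val z * b) = val z * (a * b).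
Proof. by rewrite !mulrA ring_center_comm. Qed.

Lemma entryE a i j : val (entry a i j) = \sum_k E k i * a * E j k.
Proof. by []. Qed.

Lemma entryM a b i j :
  sg ^+ 2 * entry (a * b) i j = \sum_l entry a i l * entry b l j.
Proof.
apply: val_inj; rewrite rmorphM rmorphXn raddf_sum /=.
transitivity (\sum_l \sum_k E k i * a * (val sg * E l l) * b * E j k).
  rewrite exchange_big mulr_sumr; apply: eq_bigr => k _ /=.
  rewrite -!mulr_suml -!mulr_sumr units_sum expr2 -!mulrA.
  by rewrite !centralCA.
apply: eq_bigr => l _; rewrite /= mulr_suml; apply: eq_bigr => k _.
rewrite mulr_sumr (bigD1 k) //= big1 ?addr0 => [|m mk].
  by rewrite !mulrA -[_ * E l k * _]mulrA unitsM eqxx !mulrA.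
by rewrite !mulrA -[_ * E l k * _]mulrA unitsM eq_sym (negPf mk) mulr0 !mul0r.
Qed.

Lemma entry_unit p q i j :
  entry (E p q) i j = (sg ^+ 3) *+ ((i == p) && (j == q)).
Proof.
apply: val_inj; rewrite rmorphMn rmorphXn entryE /=.
under eq_bigr => k _ do
  rewrite unitsM mulrnAl -mulrA unitsM mulrnAr -mulrnA mulrA mulnb andbC.
by rewrite sumrMnl -mulr_sumr units_sum exprSr expr2 [j == q]eq_sym.
Qed.

Lemma entry1 i j : entry 1 i j = (sg ^+ 2) *+ (i == j).
Proof.
apply: val_inj; rewrite rmorphMn rmorphXn entryE /=.
under eq_bigr => k _ do rewrite mulr1 unitsM.
by rewrite sumrMnl -mulr_sumr units_sum expr2.
Qed.

Lemma entryB a b i j : entry (a - b) i j = entry a i j - entry b i j.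
Proof.
apply: val_inj; rewrite rmorphB !entryE -sumrB; apply: eq_bigr => k _.
by rewrite mulrBr mulrBl.
Qed.

Lemma entryZ (z : Z) a i j : entry (val z * a) i j = z * entry a i j.
Proof.
apply: val_inj; rewrite rmorphM !entryE mulr_sumr; apply: eq_bigr => k _.
by rewrite !mulrA -ring_center_comm.
Qed.

Lemma entry_expand a :
  \sum_i \sum_j val (entry a i j) * E i j = val sg ^+ 3 * a.
Proof.
transitivity (\sum_i \sum_j E i i * a * (val sg * E j j)).
  apply: eq_bigr => i _; apply: eq_bigr => j _; rewrite entryE mulr_suml.
  rewrite (bigD1 i) //= big1 ?addr0 => [|k ki].
    by rewrite -mulrA unitsM eqxx.
  by rewrite -mulrA unitsM (negPf ki) mulr0.
under eq_bigr => i _ do rewrite -mulr_sumr -mulr_sumr units_sum -expr2.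
rewrite -!mulr_suml units_sum !exprS expr0 mulr1 -!mulrA.
by rewrite centralCA -(ring_center_comm sg a).
Qed.

Let r : F := sval (cid (fraction_inv sg0)).
Let sgr : iota sg * r = 1 := svalP (cid (fraction_inv sg0)).

Definition entries_mx a : 'M[F]_n := \matrix_(i, j) (r ^+ 2 * iota (entry a i j)).

Lemma entries_mx_zmod_morphism : zmod_morphism entries_mx.
Proof. by move=> a b; apply/matrixP => i j; rewrite !mxE entryB rmorphB mulrBr. Qed.

Lemma entries_mx_monoid_morphism : monoid_morphism entries_mx.
Proof.
have r2 : r ^+ 2 * iota (sg ^+ 2) = 1.
  by rewrite rmorphXn -exprMn mulrC sgr expr1n.
split.
  apply/matrixP => i j; rewrite !mxE entry1 rmorphMn mulrnAr r2.
  by case: (i == j).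
move=> a b; apply/matrixP => i j; rewrite !mxE.
under eq_bigr => l _ do rewrite !mxE mulrACA -rmorphM.
rewrite -mulr_sumr -rmorph_sum /= -entryM rmorphM mulrA -[_ * iota (sg ^+ 2)]mulrA.
by rewrite r2 mulr1.
Qed.

HB.instance Definition _ := GRing.isZmodMorphism.Build A 'M[F]_n
  entries_mx entries_mx_zmod_morphism.
HB.instance Definition _ := GRing.isMonoidMorphism.Build A 'M[F]_n
  entries_mx entries_mx_monoid_morphism.

Lemma entries_mxZ (z : Z) : entries_mx (val z) = (iota z)%:M.
Proof.
have r2 : r ^+ 2 * iota (sg ^+ 2) = 1.
  by rewrite rmorphXn -exprMn mulrC sgr expr1n.
apply/matrixP => i j; rewrite !mxE -[val z]mulr1 entryZ entry1.
rewrite mulrnAr rmorphMn rmorphM mulrnAr mulrCA r2 mulr1.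
by case: (i == j).
Qed.

Lemma entries_mx_unit p q : entries_mx (E p q) = iota sg *: delta_mx p q.
Proof.
apply/matrixP => i j; rewrite !mxE entry_unit.
case: (_ && _); rewrite ?mulr0n ?rmorph0 ?mulr0 // mulr1 (exprS sg) rmorphM mulrCA.
by rewrite rmorphXn -exprMn [r * _]mulrC sgr expr1n mulr1.
Qed.

Lemma matrix_units_iso :
  exists (psi : {rmorphism A -> 'M[F]_n})
         (phi : {rmorphism central_loc A -> 'M[F]_n}),
  [/\ bijective phi,
      forall a x, phi (tens _ a x) = x *: psi a,
      injective psi,
      forall z : Z, psi (val z) = (iota z)%:M
    & forall X, exists c : 'I_n -> 'I_n -> F,
        X = \sum_i \sum_j c i j *: psi (E i j)].
Proof.
have [phi phiE] := tensor_extension entries_mxZ.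
(* The inverse expands a matrix along the units, [E i j] being [sg] times one. *)
pose unphi (X : 'M[F]_n) : central_loc A :=
  \sum_i \sum_j tens iota (E i j) (X i j * r).
have unit_span (X : 'M[F]_n) :
    X = \sum_i \sum_j (X i j * r) *: entries_mx (E i j).
  rewrite [LHS]matrix_sum_delta; apply: eq_bigr => i _; apply: eq_bigr => j _.
  by rewrite entries_mx_unit scalerA -mulrA [r * _]mulrC sgr mulr1.
have unphiK : cancel unphi phi.
  move=> X; rewrite [RHS]unit_span rmorph_sum; apply: eq_bigr => i _.
  by rewrite rmorph_sum; apply: eq_bigr => j _; exact: phiE.
have unphi0 : unphi 0 = 0.
  apply: big1 => i _; apply: big1 => j _; by rewrite mxE mul0r tens0r.
have unphiD X Y : unphi (X + Y) = unphi X + unphi Y.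
  rewrite -big_split; apply: eq_bigr => i _; rewrite -big_split.
  by apply: eq_bigr => j _; rewrite mxE mulrDl tensDr.
have r2 : iota (sg ^+ 2) * r ^+ 2 = 1 by rewrite rmorphXn -exprMn sgr expr1n.
have r3 : iota (sg ^+ 3) * r ^+ 3 = 1 by rewrite rmorphXn -exprMn sgr expr1n.
have phiK : cancel phi unphi.
  apply: ctensor_ind => [|a x t IH]; first by rewrite rmorph0 unphi0.
  rewrite rmorphD unphiD IH phiE; congr (_ + _).
  transitivity (tens iota (\sum_i \sum_j val (entry a i j) * E i j) (x * r ^+ 3)).
    rewrite tens_suml; apply: eq_bigr => i _.
    rewrite tens_suml; apply: eq_bigr => j _.
    rewrite !mxE ring_center_comm tensZ; congr (tens _ _ _).
    by rewrite exprS; ring.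
  rewrite entry_expand -rmorphXn ring_center_comm tensZ mulrCA r3 mulr1 //.
exists entries_mx, phi; split=> //; first by exists unphi.
- move=> a b /matrixP ab; apply/eqP; rewrite -subr_eq0; apply/eqP.
  have c0 i j : entry (a - b) i j = 0.
    apply: iota_inj; rewrite rmorph0 entryB rmorphB.
    have := congr1 (fun y => iota (sg ^+ 2) * y) (ab i j).
    by rewrite !mxE !(mulrA _ (r ^+ 2)) r2 !mul1r /= => ->; rewrite subrr.
  have : val (sg ^+ 3) * (a - b) = 0.
    rewrite rmorphXn -entry_expand; apply: big1 => i _; apply: big1 => j _.
    by rewrite c0 mul0r.
  case/torsionfree => // s3; exfalso.
  have : iota (sg ^+ 3) * r ^+ 3 = 0 by rewrite s3 rmorph0 mul0r.
  by rewrite r3 => /(proj1 fractions_field).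
- exact: entries_mxZ.
- move=> X; exists (fun i j => X i j * r).
  by rewrite [LHS]unit_span.
Qed.

Lemma matrix_units_full : (0 < n)%N -> full A n.
Proof.
move=> n0; have [P PE] := zero_prime_ideal center_domain.
have [psi [phi [[phi' phiK phi'K] phiE _ psiZ _]]] := matrix_units_iso.
have [z|g [g' gK g'K] gE] := @loc_eq_iso Z (@nonzerodiv Z) (prime_compl P).
  by rewrite nonzerodivE; apply/esym/(congr1 negb); exact: PE.
exists 1%N, (fun=> P), (fun=> n), (fun=> map_mx g \o phi); split.
- split=> [i j _|Q]; first by rewrite !ord1.
  split=> [Qmin|[_ QP] Q' Q'Q].
    exists 0 => z; apply/esym/Qmin => {}z; rewrite PE inE => /eqP->.
    exact: rpred0.
  move=> z; apply/idP/idP => [/Q'Q//|]; rewrite QP PE inE => /eqP->.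
  exact: rpred0.
- by [].
- move=> _ z; rewrite /= phiE scale1r psiZ; apply/matrixP => i j.
  by rewrite !mxE rmorphMn gE.
- exists (fun X => phi' (map_mx g' (X 0))) => [t|X] /=.
    rewrite -map_mx_comp map_mx_id ?phiK //.
  apply/functional_extensionality_dep => i; rewrite ord1 /= phi'K.
  by rewrite -map_mx_comp map_mx_id.
- by rewrite big_ord1.
Qed.

Lemma matrix_units_order (psi : {rmorphism A -> 'M[F]_n}) :
  (forall z : Z, psi (val z) = (iota z)%:M) ->
  (forall X, exists c : 'I_n -> 'I_n -> F,
     X = \sum_i \sum_j c i j *: psi (E i j)) ->
  (exists (m : nat) (g : 'I_m -> A), forall a, exists c : 'I_m -> Z,
     a = \sum_j val (c j) * g j) ->
  is_order iota (range psi).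
Proof.
move=> psiZ psi_span [m [g gP]]; split.
- by exists 1 => //; rewrite rmorph1.
- move=> _ _ [a _ <-] [b _ <-]; split.
    by exists (a - b) => //; rewrite rmorphB.
  by exists (a * b) => //; rewrite rmorphM mulmxE.
- have sumE (c : 'I_m -> Z) :
      psi (\sum_j val (c j) * g j) = \sum_j iota (c j) *: psi (g j).
    rewrite rmorph_sum; apply: eq_bigr => j _.
    by rewrite rmorphM [X in X * _]psiZ -mulmxE mul_scalar_mx.
  exists m, (psi \o g) => X; split=> [[a _ <-]|[c ->]].
    by have [c ->] := gP a; exists c; rewrite sumE.
  by exists (\sum_j val (c j) * g j).
- move=> X; have [c ->] := psi_span X.
  exists #|{: 'I_n * 'I_n}|, (fun k => c (enum_val k).1 (enum_val k).2),
    (fun k => psi (E (enum_val k).1 (enum_val k).2)); split.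
    by move=> j; exists (E (enum_val j).1 (enum_val j).2).
  rewrite pair_big (reindex (@enum_val _ {: 'I_n * 'I_n})) //=.
  by apply: onW_bij; exact: enum_val_bij.
Qed.
End MatrixUnits.

(** * Two by two matrices over a domain *)

Section TwoByTwo.
Variable R : idomainType.
Implicit Types X Y M N U V : 'M[R]_2.

Lemma ord2P (i : 'I_2) : i = 0 \/ i = 1.
Proof. by case: i => [[|[|//]]] h; [left | right]; apply: val_inj. Qed.

Lemma mx2P X Y : X 0 0 = Y 0 0 -> X 0 1 = Y 0 1 -> X 1 0 = Y 1 0 ->
  X 1 1 = Y 1 1 -> X = Y.
Proof.
move=> e00 e01 e10 e11; apply/matrixP => i j.
by case: (ord2P i) => ->; case: (ord2P j) => ->.
Qed.

Lemma mul2E X Y i j : (X * Y) i j = X i 0 * Y 0 j + X i 1 * Y 1 j.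
Proof.
rewrite -mulmxE mxE !big_ord_recl big_ord0 addr0.
by congr (_ + X i _ * Y _ j); apply: val_inj.
Qed.

Lemma sub2E X Y i j : (X - Y) i j = X i j - Y i j.
Proof. by rewrite !mxE. Qed.

Lemma add2E X Y i j : (X + Y) i j = X i j + Y i j.
Proof. by rewrite !mxE. Qed.

(** Two vectors of a three-dimensional space that are parallel to the same nonzero
    vector are parallel; parallelism is the vanishing of the two by two minors. *)
Lemma parallel_trans (a b c : R) (x y z x' y' z' : R) : (a, b, c) != (0, 0, 0) ->
  a * y = b * x -> a * z = c * x -> b * z = c * y ->
  a * y' = b * x' -> a * z' = c * x' -> b * z' = c * y' ->
  [/\ x * y' = y * x', x * z' = z * x' & y * z' = z * y'].
Proof.
rewrite !xpair_eqE !negb_and -orbA => abc h1 h2 h3 h1' h2' h3'.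
have cancel (d u v : R) : d != 0 -> d * u = d * v -> u = v by move=> d0 /(mulfI d0).
case/or3P: abc => /cancel cd.
- have e1 : x * y' = y * x'.
    apply: cd; transitivity (x * (a * y')); first by ring.
    by rewrite h1' mulrA [a * _]mulrA h1; ring.
  have e2 : x * z' = z * x'.
    apply: cd; transitivity (x * (a * z')); first by ring.
    by rewrite h2' mulrA [a * _]mulrA h2; ring.
  split=> //; apply: cd.
  transitivity ((a * y) * z'); first by ring.
  rewrite h1; transitivity (b * (x * z')); first by ring.
  rewrite e2; transitivity (z * (b * x')); first by ring.
  by rewrite -h1'; ring.
- have e1 : x * y' = y * x'.
    apply: cd; transitivity ((b * x) * y'); first by ring.
    rewrite -h1; transitivity (y * (a * y')); first by ring.
    by rewrite h1'; ring.
  have e3 : y * z' = z * y'.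
    apply: cd; transitivity (y * (b * z')); first by ring.
    rewrite h3'; transitivity ((c * y) * y'); first by ring.
    by rewrite -h3; ring.
  split=> //; apply: cd.
  transitivity ((b * x) * z'); first by ring.
  rewrite -h1; transitivity (a * (y * z')); first by ring.
  rewrite e3; transitivity (z * (a * y')); first by ring.
  by rewrite h1'; ring.
- have e2 : x * z' = z * x'.
    apply: cd; transitivity ((c * x) * z'); first by ring.
    rewrite -h2; transitivity (z * (a * z')); first by ring.
    by rewrite h2'; ring.
  have e3 : y * z' = z * y'.
    apply: cd; transitivity ((c * y) * z'); first by ring.
    rewrite -h3; transitivity (z * (b * z')); first by ring.
    by rewrite h3'; ring.
  split=> //; apply: cd.
  transitivity ((c * x) * y'); first by ring.
  rewrite -h2; transitivity (a * (z * y')); first by ring.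
  rewrite -e3; transitivity (y * (a * z')); first by ring.
  by rewrite h2'; ring.
Qed.

(** Commutation means that the traceless parts are parallel. *)
Lemma commute2P X Y : X * Y = Y * X <->
  [/\ X 0 1 * Y 1 0 = X 1 0 * Y 0 1,
      X 0 1 * (Y 1 1 - Y 0 0) = (X 1 1 - X 0 0) * Y 0 1
    & X 1 0 * (Y 1 1 - Y 0 0) = (X 1 1 - X 0 0) * Y 1 0].
Proof.
split=> [/matrixP e|[e1 e2 e3]].
  move: (e 0 0) (e 0 1) (e 1 0); rewrite !mul2E => e1 e2 e3; split.
  - apply: (addrI (X 0 0 * Y 0 0)); rewrite e1; ring.
  - apply: (addrI (X 0 0 * Y 0 1)).
    transitivity ((X 0 0 * Y 0 1 + X 0 1 * Y 1 1) - X 0 1 * Y 0 0); first by ring.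
    by rewrite e2; ring.
  - apply: (addrI (Y 1 0 * X 0 0)).
    transitivity (Y 1 0 * X 0 0 + Y 1 1 * X 1 0 - X 1 0 * Y 0 0); first by ring.
    by rewrite -e3; ring.
apply: mx2P; rewrite !mul2E.
- by rewrite e1; ring.
- transitivity (X 0 0 * Y 0 1 + X 0 1 * (Y 1 1 - Y 0 0) + X 0 1 * Y 0 0);
    first by ring.
  by rewrite e2; ring.
- transitivity (X 1 1 * Y 1 0 + Y 1 1 * X 1 0 - X 1 0 * (Y 1 1 - Y 0 0));
    first by ring.
  by rewrite e3; ring.
- by rewrite -e1; ring.
Qed.

(** The traceless part of [M] is parallel to those of [X] and [Y]; if it were
    nonzero then these would be parallel to each other. *)
Lemma centralizer_scalar M X Y :
  M * X = X * M -> M * Y = Y * M -> X * Y <> Y * X -> exists f, M = f%:M.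
Proof.
move=> /commute2P[h1 h2 h3] /commute2P[h1' h2' h3'] XY.
have [e|m0] := eqVneq (M 0 1, M 1 0, M 1 1 - M 0 0) (0, 0, 0).
  exists (M 0 0); case: e => e1 e2 /eqP; rewrite subr_eq0 => /eqP e3.
  by apply: mx2P; rewrite !mxE ?e1 ?e2 ?e3.
case: XY; apply/commute2P.
exact: (parallel_trans m0 h1 h2 h3 h1' h2' h3').
Qed.

Lemma traceless_sqr M : M 0 0 + M 1 1 = 0 -> exists f, M * M = f%:M.
Proof.
move/eqP; rewrite addr_eq0 => /eqP e; exists (M 0 0 ^+ 2 + M 0 1 * M 1 0).
by apply: mx2P; rewrite !mul2E !mxE /= e; ring.
Qed.

Lemma commutator_traceless X Y : (X * Y - Y * X) 0 0 + (X * Y - Y * X) 1 1 = 0.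
Proof. by rewrite !sub2E !mul2E; ring. Qed.

Lemma nilpotent_traceless N : N * N = 0 -> N 0 0 + N 1 1 = 0.
Proof.
move=> /matrixP e; move: (e 0 0) (e 0 1) (e 1 0) (e 1 1).
rewrite !mul2E !mxE => e00 e01 e10 e11.
have [//|t0] := eqVneq (N 0 0 + N 1 1) 0.
have b0 : N 0 1 = 0.
  by apply: (mulfI t0); rewrite mulr0 -e01; ring.
move: e00 e11; rewrite b0 !(mul0r, mulr0) addr0 add0r.
by move=> /eqP; rewrite mulf_eq0 orbb => /eqP-> /eqP; rewrite mulf_eq0 orbb => /eqP->; rewrite addr0.
Qed.

(** The scalar [t] is the trace of [N * V].  Since [N] has trace and determinant
    zero, the three identities are instances of the Cayley-Hamilton theorem, the
    differences of the two sides being multiples of the determinant [- D]. *)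
Lemma nilpotent_sandwich N V : N * N = 0 -> exists t,
  [/\ N * V * N = t *: N, (N * V - V * N) * (N * V - V * N) = (t ^+ 2)%:M
    & exists s, V * N + N * V = t%:M + s *: N].
Proof.
move=> N2; have /eqP := nilpotent_traceless N2; rewrite addr_eq0 => /eqP tr0.
have /matrixP/(_ 0 0) := N2; rewrite mul2E mxE tr0; set d := N 1 1 => det0.
have {}tr0 : N 0 0 = - d by [].
set D := - d * - d + N 0 1 * N 1 0 in det0.
exists (N 0 0 * V 0 0 + N 0 1 * V 1 0 + N 1 0 * V 0 1 + N 1 1 * V 1 1); split.
- have NVN i j : (N * V * N) i j =
      (N i 0 * V 0 0 + N i 1 * V 1 0) * N 0 j +
      (N i 0 * V 0 1 + N i 1 * V 1 1) * N 1 j by rewrite !mul2E.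
  apply: mx2P; rewrite NVN !mxE tr0 -/d.
  + transitivity ((- d * V 0 0 + N 0 1 * V 1 0 + N 1 0 * V 0 1 + d * V 1 1) * - d
      + D * V 1 1); [by rewrite /D; ring | by rewrite det0 mul0r addr0].
  + transitivity ((- d * V 0 0 + N 0 1 * V 1 0 + N 1 0 * V 0 1 + d * V 1 1) * N 0 1
      + D * - V 0 1); [by rewrite /D; ring | by rewrite det0 mul0r addr0].
  + transitivity ((- d * V 0 0 + N 0 1 * V 1 0 + N 1 0 * V 0 1 + d * V 1 1) * N 1 0
      + D * - V 1 0); [by rewrite /D; ring | by rewrite det0 mul0r addr0].
  + transitivity ((- d * V 0 0 + N 0 1 * V 1 0 + N 1 0 * V 0 1 + d * V 1 1) * d
      + D * V 0 0); [by rewrite /D; ring | by rewrite det0 mul0r addr0].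
- have comm i j : (N * V - V * N) i j = N i 0 * V 0 j + N i 1 * V 1 j -
      (V i 0 * N 0 j + V i 1 * N 1 j) by rewrite sub2E !mul2E.
  have diag (x : R) : x = (- d * V 0 0 + N 0 1 * V 1 0 + N 1 0 * V 0 1 + d * V 1 1) ^+ 2
     + D * ((V 0 0 * V 1 1 - V 0 1 * V 1 0) *+ 4 - (V 0 0 + V 1 1) ^+ 2) ->
     x = (- d * V 0 0 + N 0 1 * V 1 0 + N 1 0 * V 0 1 + d * V 1 1) ^+ 2.
    by rewrite det0 mul0r addr0.
  apply: mx2P; rewrite mul2E !comm !mxE /= tr0 -/d.
  + by apply: diag; rewrite /D; ring.
  + ring.
  + ring.
  + by apply: diag; rewrite /D; ring.
- exists (V 0 0 + V 1 1).
  by apply: mx2P; rewrite !add2E !mul2E !mxE /= tr0 -/d; ring.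
Qed.
End TwoByTwo.

(** * Semiprime noncommutative subalgebras of M_2(K[t]) *)

Lemma same_residueE (D m n : nat) : (0 < m)%N -> (0 < n)%N -> (m <= n)%N ->
  (m.-1 %% D)%N = (n.-1 %% D)%N -> (D * (n.-1 %/ D - m.-1 %/ D) + m)%N = n.
Proof.
move=> m0 n0 mn e; have := leq_div2r D (leq_sub2r 1 mn); rewrite !subn1.
have := divn_eq m.-1 D; have := divn_eq n.-1 D; rewrite e mulnBr ![(D * _)%N]mulnC.
move: (_ %% D)%N (n.-1 %/ D)%N (m.-1 %/ D)%N => w x y e1 e2 /(leq_mul (leqnn D)).
by rewrite ![(D * _)%N]mulnC; lia.
Qed.

Section SubalgebraOfM2.
Local Open Scope classical_set_scope.
Variables (K : closedFieldType) (A : nzRingType).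
Variable Lam : {rmorphism A -> 'M[{poly K}]_2}.
Hypothesis two0 : 2%:R != 0 :> K.
Hypothesis Lam_inj : injective Lam.
Hypothesis constants : forall c : K, exists a, Lam a = c%:P%:M.
Hypothesis noncommutative : exists D E : A, D * E <> E * D.
Hypothesis semiprime : forall u : A, u != 0 -> exists v, u * v * u != 0.
Local Notation Z := (ring_center A).

Lemma scalar_mulE (f : {poly K}) (X : 'M[{poly K}]_2) : f%:M * X = f *: X.
Proof. by rewrite -mulmxE mul_scalar_mx. Qed.

Lemma mul_scalarE (f : {poly K}) (X : 'M[{poly K}]_2) : X * f%:M = f *: X.
Proof. by rewrite -mulmxE mul_mx_scalar. Qed.

Definition scalars : {pred {poly K}} := fun f => `[< exists a, Lam a = f%:M >].

Lemma scalars_subring_closed : subring_closed scalars.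
Proof.
split.
- by apply/asboolP; exists 1; rewrite rmorph1.
- move=> f g /asboolP[a af] /asboolP[b bg]; apply/asboolP; exists (a - b).
  by rewrite rmorphB af bg raddfB.
- move=> f g /asboolP[a af] /asboolP[b bg]; apply/asboolP; exists (a * b).
  by rewrite rmorphM af bg -rmorphM.
Qed.
HB.instance Definition _ := GRing.isSubringClosed.Build {poly K} scalars
  scalars_subring_closed.

Lemma scalars_const (c : K) : c%:P \in scalars.
Proof. by apply/asboolP; exact: constants. Qed.

Lemma central_of_scalar a f : Lam a = f%:M -> a \in @ring_central A.
Proof.
move=> af; apply/centralP => b; apply: Lam_inj.
by rewrite !rmorphM af scalar_mulE mul_scalarE.
Qed.

Lemma scalar_of_central a : a \in @ring_central A -> exists f, Lam a = f%:M.
Proof.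
move=> /centralP ac; have [D [E DE]] := noncommutative.
apply: (@centralizer_scalar _ _ (Lam D) (Lam E)); rewrite -!rmorphM ?ac //.
by move=> /Lam_inj.
Qed.

Lemma center_torsionfree (z : Z) (a : A) : val z * a = 0 -> z = 0 \/ a = 0.
Proof.
have [f zf] := scalar_of_central (valP z).
move=> /(congr1 Lam); rewrite rmorphM rmorph0 zf scalar_mulE => fa0.
have [f0|f0] := eqVneq f 0; [left | right].
  by apply/val_inj/Lam_inj; rewrite zf f0 raddf0 rmorph0.
apply: Lam_inj; rewrite rmorph0; apply/matrixP => i j.
have /matrixP/(_ i j) := fa0; rewrite !mxE => /eqP.
by rewrite mulf_eq0 (negPf f0) => /eqP.
Qed.

(** In the quaternion algebra spanned by [1], [u], [w] and [u * w] the square of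
    [a * u + b * w + c * (u * w)] is a^2 d + b^2 e - c^2 d e.  With a = z e,
    b = y d and c = x this is d e (d y^2 + e z^2 - x^2), so that a point of the
    conic gives an element of square zero. *)
Lemma quaternion_nilpotent (u w : A) (d e : {poly K}) :
  Lam u * Lam u = d%:M -> Lam w * Lam w = e%:M -> u * w = - (w * u) ->
  d != 0 -> e != 0 -> exists n : A, n != 0 /\ n * n = 0.
Proof.
move=> ud we uw d0 e0.
have dS : d \in scalars by apply/asboolP; exists (u * u); rewrite rmorphM.
have eS : e \in scalars by apply/asboolP; exists (w * w); rewrite rmorphM.
have [x [y [z [[xS yS zS] [nz eq]]]]] :=
  ternary_form_isotropic_in scalars_const dS eS.
have /asboolP[a al] : z * e \in scalars by exact: rpredM.
have /asboolP[b be] : y * d \in scalars by exact: rpredM.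
have /asboolP[c ga] := xS.
set U := Lam u in ud; set W := Lam w in we.
have UW : U * W = - (W * U) by rewrite -rmorphM uw rmorphN rmorphM.
have WU : W * U = - (U * W) by rewrite UW opprK.
exists (a * u + b * w + c * (u * w)).
have LamN : Lam (a * u + b * w + c * (u * w)) =
    (z * e) *: U + (y * d) *: W + x *: (U * W).
  by rewrite !rmorphD !rmorphM al be ga !scalar_mulE.
have UUW : U * (U * W) = d *: W by rewrite mulrA ud scalar_mulE.
have UWU : U * W * U = - (d *: W) by rewrite -mulrA WU mulrN UUW.
have UWW : U * W * W = e *: U by rewrite -mulrA we mul_scalarE.
have WUW : W * (U * W) = - (e *: U) by rewrite mulrA WU mulNr UWW.
have UWUW : U * W * (U * W) = - ((d * e)%:M).
  by rewrite mulrA UWU mulNr -scalerAl we scale_scalar_mx.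
split; last first.
  apply: Lam_inj; rewrite rmorphM rmorph0 LamN !(mulrDl, mulrDr).
  rewrite -!scalerAl -!scalerAr !scalerA ud we UUW UWU UWW WUW UWUW WU.
  clear UW WU UUW UWU UWW WUW UWUW ud we uw; clearbody U W.
  move: (U * W) => V; apply/matrixP => i j; rewrite !mxE.
  case: (i == j); rewrite ?mulr1n ?mulr0n; last by ring.
  transitivity (d * e * (d * y ^+ 2 + e * z ^+ 2 - x ^+ 2)); first by ring.
  by rewrite -eq subrr mulr0.
have two : 2%:R != 0 :> {poly K} by rewrite -polyC_natr polyC_eq0.
have scal0 (f g : {poly K}) : g != 0 -> (2%:R * f * g)%:M = 0 :> 'M[{poly K}]_2 ->
    f = 0.
  move=> g0 /matrixP/(_ 0 0); rewrite !mxE => /eqP.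
  by rewrite !mulf_eq0 (negPf g0) (negPf two) orbF => /eqP.
(* Anticommutators with [u] and [w] isolate the coefficients. *)
apply: contraNneq nz => N0.
have := congr1 Lam N0; rewrite LamN rmorph0 => {}N0.
have ze : z * e = 0.
  apply: (@scal0 _ d) => //.
  have : ((z * e) *: U + (y * d) *: W + x *: (U * W)) * U
       + U * ((z * e) *: U + (y * d) *: W + x *: (U * W)) = 0.
    by rewrite N0 mul0r mulr0 addr0.
  rewrite !(mulrDl, mulrDr) -!scalerAl -!scalerAr ud UUW UWU WU => <-.
  move: (U * W) => V; apply/matrixP => i j; rewrite !mxE.
  by case: (i == j); rewrite ?mulr1n ?mulr0n; ring.
have yd : y * d = 0.
  apply: (@scal0 _ e) => //.
  have : ((z * e) *: U + (y * d) *: W + x *: (U * W)) * W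
       + W * ((z * e) *: U + (y * d) *: W + x *: (U * W)) = 0.
    by rewrite N0 mul0r mulr0 addr0.
  rewrite !(mulrDl, mulrDr) -!scalerAl -!scalerAr we UWW WUW WU => <-.
  move: (U * W) => V; apply/matrixP => i j; rewrite !mxE.
  by case: (i == j); rewrite ?mulr1n ?mulr0n; ring.
have y0 : y = 0 by move/eqP: yd; rewrite mulf_eq0 (negPf d0) orbF => /eqP.
have z0 : z = 0 by move/eqP: ze; rewrite mulf_eq0 (negPf e0) orbF => /eqP.
move/eqP: eq; rewrite y0 z0 expr0n !mulr0 addr0 sqrf_eq0 => /eqP->.
exact: eqxx.
Qed.

(** Start from a nonzero commutator [u].  If it commuted with both of its
    factors, which do not commute, then it would be scalar and traceless, that is
    zero; so some commutator [w] of [u] is nonzero.  Either [u] or [w] squares to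
    zero, or they generate a quaternion algebra. *)
Lemma exists_nilpotent : exists n : A, n != 0 /\ n * n = 0.
Proof.
have [a [b ab]] := noncommutative; set u := a * b - b * a.
have u0 : u != 0 by rewrite subr_eq0; apply/eqP.
have LamC x y : Lam (x * y - y * x) = Lam x * Lam y - Lam y * Lam x.
  by rewrite rmorphB !rmorphM.
have sqr x y : exists f, Lam (x * y - y * x) * Lam (x * y - y * x) = f%:M.
  by apply: traceless_sqr; rewrite LamC commutator_traceless.
have sqr0 x f : Lam x * Lam x = f%:M -> f = 0 -> x * x = 0.
  by move=> xx f0; apply: Lam_inj; rewrite rmorphM xx f0 raddf0 rmorph0.
have [d ud] := sqr a b; rewrite -/u in ud.
have [/(sqr0 _ _ ud) uu|d0] := eqVneq d 0; first by exists u.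
have ucomm f : Lam (u * u) = f%:M -> forall x, u * u * x = x * (u * u).
  by move=> uf x; apply: Lam_inj; rewrite !rmorphM -rmorphM uf scalar_mulE mul_scalarE.
have anti x : u * (u * x - x * u) = - ((u * x - x * u) * u).
  rewrite mulrBr [X in _ = - X]mulrBl opprB.
  by rewrite !mulrA (ucomm d) ?rmorphM // !mulrA.
have [x ux] : exists x, u * x - x * u != 0.
  have [ua|] := eqVneq (u * a - a * u) 0; last by exists a.
  have [ub|] := eqVneq (u * b - b * u) 0; last by exists b.
  exfalso; have [|||f uf] := @centralizer_scalar _ (Lam u) (Lam a) (Lam b).
  - by rewrite -!rmorphM; congr (Lam _); apply/eqP; rewrite -subr_eq0 ua.
  - by rewrite -!rmorphM; congr (Lam _); apply/eqP; rewrite -subr_eq0 ub.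
  - by rewrite -!rmorphM => /Lam_inj.
  have := commutator_traceless (Lam a) (Lam b); rewrite -LamC -/u uf !mxE /=.
  rewrite mulr1n -mulr2n -[f *+ 2]mulr_natr => /eqP.
  rewrite mulf_eq0 -polyC_natr polyC_eq0.
  rewrite (negPf two0) orbF => /eqP f0; move/eqP: u0; apply; apply: Lam_inj.
  by rewrite uf f0 raddf0 rmorph0.
set w := u * x - x * u in ux.
have [e we] := sqr u x; rewrite -/w in we.
have [/(sqr0 _ _ we) ww|e0] := eqVneq e 0; first by exists w.
exact: (quaternion_nilpotent ud we (anti x) d0 e0).
Qed.

(** If [n * n = 0] and [n * v * n = T * n] then [n * v / T] is an idempotent and
    [n] intertwines it with its complement [q / T].  The scaling by [T] makes
    [T ^+ 2] the common denominator of the four units. *)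
Definition scaled_units (n v T : A) (i j : 'I_2) : A :=
  let q := T - n * v in
  if i == 0 then (if j == 0 then T * (n * v) else T * n)
  else (if j == 0 then q * v * n * v else T * q).

(** Here [n * v0 * n = t *: n] where [t] is the trace of [n * v0], and [t] may fail
    to come from a central element.  For [v = v0 * n * v0] the trace becomes
    [t ^+ 2], which is the square of the commutator of [n] and [v0], hence
    central. *)
Lemma exists_scaled_units : exists (n v : A) (T : Z),
  [/\ T != 0, n * n = 0, n * v * n = val T * n &
      (val T - n * v) * v * n = val T * (val T - n * v)].
Proof.
have [n [n0 nn]] := exists_nilpotent; have [v nvn] := semiprime n0.
have [|t [NVN comm _]] := @nilpotent_sandwich _ (Lam n) (Lam v).
  by rewrite -rmorphM nn rmorph0.
pose c := (n * v - v * n) * (n * v - v * n).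
have Lamc : Lam c = (t ^+ 2)%:M by rewrite -comm /c rmorphM rmorphB !rmorphM.
clearbody c.
exists n, (v * n * v), (RingCenter (central_of_scalar Lamc)).
have t0 : t != 0.
  apply: contraNneq nvn => t0; apply/eqP/Lam_inj.
  by rewrite !rmorphM NVN t0 scale0r rmorph0.
have [|s [NV'N _ [r V'N]]] := @nilpotent_sandwich _ (Lam n) (Lam (v * n * v)).
  by rewrite -rmorphM nn rmorph0.
have n'E : n * (v * n * v) * n = c * n.
  apply: Lam_inj; rewrite [RHS]rmorphM Lamc scalar_mulE.
  have -> : n * (v * n * v) * n = (n * v * n) * v * n by rewrite !mulrA.
  rewrite 2!rmorphM [X in X * _ * _]rmorphM [X in X * _ * _ * _]rmorphM.
  by rewrite NVN -!scalerAl NVN scalerA expr2.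
have Lamn0 : Lam n != 0.
  by apply: contraNneq n0 => n00; apply/eqP/Lam_inj; rewrite n00 rmorph0.
have st : s = t ^+ 2.
  have [i [j nij]] : exists i j, Lam n i j != 0.
    apply: contrapT => /forallNP nn0; move/eqP: Lamn0; apply; apply/matrixP => i j.
    have /forallNP/(_ j)/negP := nn0 i; rewrite negbK => /eqP->; by rewrite mxE.
  have := congr1 Lam n'E; rewrite 2!rmorphM NV'N [RHS]rmorphM Lamc scalar_mulE.
  by move=> /matrixP/(_ i j); rewrite !mxE => /(mulIf nij).
set v' := v * n * v in n'E NV'N V'N *; clearbody v'.
split=> //=.
- apply/eqP => /(congr1 val) /(congr1 Lam); rewrite Lamc rmorph0.
  by move=> /matrixP/(_ 0 0); rewrite !mxE => /eqP; rewrite expf_eq0 (negPf t0).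
- have QN : (Lam c - Lam n * Lam v') * Lam n = 0.
    by rewrite mulrBl Lamc scalar_mulE NV'N st subrr.
  have LamQ : Lam (c - n * v') = Lam c - Lam n * Lam v'.
    by rewrite rmorphB rmorphM.
  apply: Lam_inj; rewrite -mulrA rmorphM LamQ rmorphM [RHS]rmorphM LamQ.
  have -> : Lam v' * Lam n = Lam c + r *: Lam n - Lam n * Lam v'.
    by rewrite Lamc -st -V'N addrK.
  rewrite mulrBr mulrDr -scalerAr QN scaler0 addr0 mulrA QN mul0r subr0.
  by rewrite Lamc scalar_mulE mul_scalarE.
Qed.

Lemma scaled_units_mul n v (T : Z) : n * n = 0 -> n * v * n = val T * n ->
  (val T - n * v) * v * n = val T * (val T - n * v) ->
  let E := scaled_units n v (val T) in
  forall i j k l, E i j * E k l = (val (T ^+ 2) * E i l) *+ (j == k).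
Proof.
set t := val T; set q := t - n * v => nn nvn qvn E.
have tC a : t * a = a * t by exact: ring_center_comm.
have nq : n * q = t * n by rewrite mulrBr mulrA nn mul0r subr0 tC.
have qn : q * n = 0 by rewrite mulrBl nvn subrr.
have pq : n * v * q = 0   by rewrite mulrBr -tC [n * v * (n * v)]mulrA nvn -mulrA subrr.
have qq : q * q = t * q by rewrite {2}/q mulrBr mulrA qn mul0r subr0 tC.
have tA a b : a * (t * b) = t * (a * b) by rewrite mulrA -tC mulrA.
have T2 : val (T ^+ 2) = t * t by rewrite rmorphXn expr2.
have nvn' : n * (v * n) = t * n by rewrite mulrA.
have qvn' : q * (v * n) = t * q by rewrite mulrA.
have pq' : n * (v * q) = 0 by rewrite mulrA.
have qvq : q * (v * q) = 0.
  by rewrite mulrA {2}/q mulrBr -tC (mulrA (q * v)) qvn -mulrA subrr.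
have app (a b c : A) : a * b = c -> forall x, a * (b * x) = c * x.
  by move=> e x; rewrite mulrA e.
have app3 (a b c d : A) : a * (b * c) = d -> forall x, a * (b * (c * x)) = d * x.
  by move=> e x; rewrite -e !mulrA.
pose rules := (nn, nq, qn, qq, nvn', qvn', pq', qvq, app _ _ _ nn, app _ _ _ nq,
  app _ _ _ qn, app _ _ _ qq, app3 _ _ _ _ nvn', app3 _ _ _ _ qvn',
  app3 _ _ _ _ pq', app3 _ _ _ _ qvq).
move=> i j k l; rewrite T2 {}/E.
by case: (ord2P i) => ->; case: (ord2P j) => ->; case: (ord2P k) => ->;
  case: (ord2P l) => ->; rewrite /scaled_units /= -/q ?mulr0n ?mulr1n -?mulrA;
  do 3?[progress rewrite -?mulrA ?(tA, rules, mul0r, mulr0)].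
Qed.

Lemma scaled_units_sum n v (T : Z) :
  \sum_i scaled_units n v (val T) i i = val (T ^+ 2).
Proof.
rewrite !big_ord_recl big_ord0 addr0 /scaled_units /= -mulrDr addrCA subrr addr0.
by [].
Qed.


(** The sum commutes with all the [E p q].  As [E 0 1] and [E 1 0] do not commute,
    it is a scalar matrix. *)
Lemma units_entry_central (E : 'I_2 -> 'I_2 -> A) (sg : Z) : sg != 0 ->
  (forall i j k l, E i j * E k l = (val sg * E i l) *+ (j == k)) ->
  \sum_i E i i = val sg ->
  forall a i j, \sum_k E k i * a * E j k \in @ring_central A.
Proof.
move=> sg0 EE Es a i j; set z := \sum_k _.
have zE p q : z * E p q = E p q * z.
  rewrite mulr_suml mulr_sumr (bigD1 p) //= [RHS](bigD1 q) //=.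
  rewrite !big1 ?addr0 => [|k kq|k kp].
  - by rewrite -[LHS]mulrA EE eqxx mulr1n centralCA !mulrA EE eqxx mulr1n.
  - by rewrite !mulrA EE eq_sym (negPf kq) !mul0r.
  - by rewrite -mulrA EE (negPf kp) mulr0.
have sgE k : val sg * E k k = 0 -> False.
  move=> /center_torsionfree[|Ek]; first exact/eqP.
  have E0 p : E p p = 0.
    have := EE p k k p; rewrite eqxx mulr1n; have := EE p k k k.
    rewrite Ek mulr0 eqxx mulr1n => /esym/center_torsionfree[sg00|->].
      by rewrite sg00 eqxx in sg0.
    rewrite mul0r => /esym/center_torsionfree[sg00|//].
    by rewrite sg00 eqxx in sg0.
  move/eqP: sg0; apply; apply: val_inj; rewrite -Es rmorph0.
  exact: big1.
have [f zf] : exists f, Lam z = f%:M.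
  apply: (@centralizer_scalar _ _ (Lam (E 0 1)) (Lam (E 1 0))).
  - by rewrite -!rmorphM zE.
  - by rewrite -!rmorphM zE.
  rewrite -!rmorphM !EE !eqxx !mulr1n => /Lam_inj/(congr1 (fun x => x * E 0 0)).
  rewrite -!mulrA !EE eqxx /= mulr1n mulr0n mulr0.
  by move=> /center_torsionfree[/eqP|/sgE//]; rewrite (negPf sg0).
exact: (central_of_scalar zf).
Qed.

(** The four entries are packed into the coefficients of one polynomial, in the
    residue classes of the exponents modulo 4; multiplication by a scalar [f]
    becomes multiplication by [f \Po 'X^4].  Degree arguments on A thus concern
    single polynomials. *)
Definition interleave (X : 'M[{poly K}]_2) : {poly K} :=
  \sum_(i < 2) \sum_(j < 2) (X i j \Po 'X^4) * 'X^(2 * i + j).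

Lemma coef_interleave_term (p : {poly K}) (c c' k : nat) :
  (c < 4)%N -> (c' < 4)%N ->
  ((p \Po 'X^4) * 'X^c')`_(4 * k + c) = if c == c' then p`_k else 0.
Proof.
move=> c4 c4'; rewrite coefMXn; case: eqP => [->|/eqP cc].
  rewrite ltnNge leq_addl /= addnK coef_comp_poly_Xn // dvdn_mulr //.
  by rewrite mulKn.
case: ltnP => // le; rewrite coef_comp_poly_Xn //; case: ifP => // /dvdnP[m e].
by exfalso; move/eqP: cc; lia.
Qed.

Lemma coef_interleave X (i j : 'I_2) k :
  (interleave X)`_(4 * k + (2 * i + j)) = (X i j)`_k.
Proof.
rewrite /interleave coef_sum (bigD1 i) //= coef_sum (bigD1 j) //=.
have lt4 (i' j' : 'I_2) : (2 * i' + j' < 4)%N.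
  by move: (ltn_ord i') (ltn_ord j'); lia.
rewrite coef_interleave_term // eqxx big1 => [|j' jj']; last first.
  rewrite coef_interleave_term // eqn_add2l ifN //.
  by apply: contraNneq jj' => e; apply/eqP/val_inj.
rewrite big1 ?addr0 // => i' ii'; rewrite coef_sum big1 // => j' _.
rewrite coef_interleave_term // ifN //; apply: contraNneq ii' => e.
apply/eqP/val_inj => /=; move: (ltn_ord j) (ltn_ord j') e.
by move: (nat_of_ord i) (nat_of_ord j) (nat_of_ord i') (nat_of_ord j'); lia.
Qed.

Lemma interleave_zmod_morphism : zmod_morphism interleave.
Proof.
move=> X Y; rewrite /interleave -sumrB; apply: eq_bigr => i _; rewrite -sumrB.
by apply: eq_bigr => j _; rewrite sub2E comp_polyB mulrBl.
Qed.
HB.instance Definition _ := GRing.isZmodMorphism.Build 'M[{poly K}]_2 {poly K}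
  interleave interleave_zmod_morphism.

Lemma interleave_inj : injective interleave.
Proof.
by move=> X Y e; apply/matrixP => i j; apply/polyP => k; rewrite -!coef_interleave e.
Qed.

Lemma interleaveZ (f : {poly K}) X : interleave (f *: X) = (f \Po 'X^4) * interleave X.
Proof.
rewrite /interleave mulr_sumr; apply: eq_bigr => i _; rewrite mulr_sumr.
by apply: eq_bigr => j _; rewrite mxE comp_polyM mulrA.
Qed.

(** Let [P] be the image of [p] and [D] its degree.  For each residue class of
    degrees modulo [D] pick an element whose degree is least in the class; a
    product with a power of [P] and a constant has the same leading term as any
    given element of the class, so that these elements generate. *)
Lemma finite_over_center_nonconstant (p : {poly K}) :
  p \in scalars -> (1 < size p)%N ->
  exists (m : nat) (g : 'I_m -> A), forall a, exists c : 'I_m -> Z,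
    a = \sum_j val (c j) * g j.
Proof.
move=> /asboolP[z zp] p1.
pose phi a := interleave (Lam a); pose P := p \Po 'X^4.
have phiM a : phi (z * a) = P * phi a.
  by rewrite /phi rmorphM zp scalar_mulE interleaveZ.
have phiB a b : phi (a - b) = phi a - phi b by rewrite /phi rmorphB raddfB.
have phi_inj a : phi a = 0 -> a = 0.
  rewrite /phi -[X in _ = X](raddf0 interleave) => /interleave_inj a0.
  by apply: Lam_inj; rewrite a0 rmorph0.
pose D := (size P).-1.
have D0 : (0 < D)%N.
  by rewrite /D size_comp_poly size_polyXn /= muln_gt0 andbT ltn_predRL.
have [|g gP] := @choice 'I_D A (fun r b => forall a, phi a != 0 ->
    ((size (phi a)).-1 %% D)%N = r ->
    [/\ phi b != 0, (size (phi b) <= size (phi a))%N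
      & ((size (phi b)).-1 %% D)%N = r]).
  move=> r.
  pose C n := `[< exists a, [/\ phi a != 0, ((size (phi a)).-1 %% D)%N = r
                              & size (phi a) = n] >].
  have [exC|noC] := pselect (exists n, C n); last first.
    exists 0 => a a0 ar; case: noC; exists (size (phi a)); apply/asboolP.
    by exists a.
  case: (ex_minnP exC) => n /asboolP[b [b0 br <-]] bmin; exists b => a a0 ar.
  by split=> //; apply: bmin; apply/asboolP; exists a.
exists D, g => a; have [n] := ubnP (size (phi a)); elim: n a => // n IH a sa.
have [a0|a0] := eqVneq (phi a) 0.
  by exists (fun=> 0); rewrite big1 ?(phi_inj _ a0) // => j _; rewrite rmorph0 mul0r.
have rD : ((size (phi a)).-1 %% D < D)%N by rewrite ltn_mod.
have [g0 ga gr] := gP (Ordinal rD) a a0 erefl; set r := Ordinal rD in g0 ga gr.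
pose k := ((size (phi a)).-1 %/ D - (size (phi (g r))).-1 %/ D)%N.
have P0 : P != 0.
  by apply: contraTneq D0 => P0; rewrite /D P0 size_poly0.
have szPk : size (P ^+ k * phi (g r)) = size (phi a).
  have sP : size (P ^+ k) = (D * k).+1.
    by rewrite -size_exp prednK // size_poly_gt0 expf_neq0.
  rewrite size_mul ?expf_neq0 // sP addSn /=.
  by rewrite same_residueE ?size_poly_gt0.
pose cc := lead_coef (phi a) / lead_coef (P ^+ k * phi (g r)).
have cc0 : cc != 0.
  by rewrite mulf_neq0 ?invr_eq0 ?lead_coef_eq0 // mulf_neq0 ?expf_neq0.
have [d dc] := constants cc.
have phid x : phi (d * x) = cc *: phi x.
  by rewrite /phi rmorphM dc scalar_mulE interleaveZ comp_polyC mul_polyC.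
have phiz x : phi (z ^+ k * x) = P ^+ k * phi x.
  elim: k {szPk cc cc0 dc phid} => [|l IHl]; first by rewrite !expr0 !mul1r.
  by rewrite !exprS -!mulrA phiM IHl.
have [|c' e] := IH (a - d * z ^+ k * g r).
  rewrite -ltnS (leq_trans _ sa) // ltnS phiB -mulrA phid phiz.
  apply: size_sub_lead => //; first by rewrite size_scale.
  by rewrite lead_coefZ divfK // lead_coef_eq0 mulf_neq0 ?expf_neq0.
have zc := central_of_scalar zp; have dcn := central_of_scalar dc.
have dzc : d * z ^+ k \in @ring_central A by rewrite rpredM ?rpredX.
exists (fun j => c' j + (if j == r then RingCenter dzc else 0)).
under eq_bigr => j _ do rewrite rmorphD mulrDl.
rewrite big_split /= -e (bigD1 r) //= eqxx big1 ?addr0 ?subrK // => j jr.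
by rewrite (negPf jr) mul0r.
Qed.

(** When all scalars are constants the center is a field, and the expansion along
    the [E i j] shows that these generate. *)
Lemma finite_over_center (E : 'I_2 -> 'I_2 -> A) (sg : Z) : sg != 0 ->
  (forall a, exists c : 'I_2 -> 'I_2 -> Z,
     \sum_i \sum_j val (c i j) * E i j = val sg ^+ 3 * a) ->
  exists (m : nat) (g : 'I_m -> A), forall a, exists c : 'I_m -> Z,
    a = \sum_j val (c j) * g j.
Proof.
move=> sg0 EP.
have [[p [pS p1]]|noS] := pselect (exists p, p \in scalars /\ (1 < size p)%N).
  exact: finite_over_center_nonconstant pS p1.
have [f sf] := scalar_of_central (valP (sg ^+ 3)).
have fE : f = (f`_0)%:P.
  apply: size1_polyC; rewrite leqNgt; apply/negP => f1; apply: noS.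
  by exists f; split=> //; apply/asboolP; exists (val (sg ^+ 3)).
have f0 : f`_0 != 0.
  apply/eqP => f00; have : val (sg ^+ 3) = 0.
    by apply: Lam_inj; rewrite sf fE f00 polyC0 raddf0 rmorph0.
  rewrite exprS expr2 !rmorphM => /center_torsionfree[/eqP|].
    by rewrite (negPf sg0).
  move=> /center_torsionfree[/eqP|s0]; first by rewrite (negPf sg0).
  by move/eqP: sg0; apply; apply: val_inj; rewrite s0 rmorph0.
have [d dE] := constants (f`_0)^-1.
pose w : Z := RingCenter (central_of_scalar dE).
exists #|{: 'I_2 * 'I_2}|, (fun k => E (enum_val k).1 (enum_val k).2) => a.
have [c cE] := EP a.
exists (fun k => w * c (enum_val k).1 (enum_val k).2).
transitivity (val w * (val sg ^+ 3 * a)).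
  apply: Lam_inj; rewrite mulrA rmorphM -rmorphXn [Lam (_ * _)]rmorphM sf dE.
  rewrite [X in _ * X%:M * _]fE scalar_mulE scale_scalar_mx -polyCM mulVf //.
  by rewrite mul1r.
rewrite -cE pair_big (reindex (@enum_val _ {: 'I_2 * 'I_2})) /=; last first.
  by apply: onW_bij; exact: enum_val_bij.
by rewrite mulr_sumr; apply: eq_bigr => k _; rewrite mulrA.
Qed.

Theorem matrix_algebra_structure :
  full A 2 /\ is_field (total_fractions Z) /\
  exists phi : {rmorphism central_loc A -> 'M[total_fractions Z]_2},
    [/\ bijective phi,
        forall x, phi (tens _ 1 x) = x%:M,
        injective (fun D : A => phi (tens _ D 1))
      & is_order (to_loc (@nonzerodiv Z)) [set phi (tens _ D 1) | D in [set: A]]].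
Proof.
have [n [v [T [T0 nn nvn qvn]]]] := exists_scaled_units.
pose E := scaled_units n v (val T).
have EE := scaled_units_mul nn nvn qvn; rewrite -/E /= in EE.
have Es : \sum_i E i i = val (T ^+ 2) := scaled_units_sum n v T.
have sg0 : T ^+ 2 != 0.
  apply/eqP => /(congr1 val); rewrite expr2 rmorphM => /center_torsionfree[].
    by move/eqP: T0.
  by move=> e; move/eqP: T0; apply; apply: val_inj.
have Ec := units_entry_central sg0 EE Es.
split; first exact: (matrix_units_full center_torsionfree sg0 EE Es Ec).
split; first exact: fractions_field center_torsionfree.
have [psi [phi [phi_bij phiE psi_inj psiZ psi_span]]] :=
  matrix_units_iso center_torsionfree sg0 EE Es Ec.
exists phi; split=> //.
- by move=> x; rewrite phiE rmorph1 scalemx1.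
- by move=> a b; rewrite !phiE !scale1r => /psi_inj.
have -> : [set phi (tens _ D 1) | D in [set: A]] = range psi.
  by apply/funext => X; apply/propext; split=> -[a _ <-]; exists a => //; rewrite phiE scale1r.
apply: (matrix_units_order psiZ psi_span); apply: (finite_over_center sg0) => a.
by exists (entry Ec a); exact: entry_expand.
Qed.
End SubalgebraOfM2.

(** * Differential operators and commutators with x *)

Section OperatorsAndX.
Variables (K : numFieldType) (n : nat).
Local Notation M := 'M[{poly K}]_n.+1.
Local Notation dermx := (@dermx K n).
Implicit Types (F G : M) (D E : {poly M}) (T : M -> M) (c : 'M[K]_n.+1).

Definition degree_lt d F : Prop := forall i j, (size (F i j) <= d)%N.

Lemma size_deriv_leq D : (size D^`() <= (size D).-1)%N.
Proof. exact: size_poly. Qed.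

Lemma degree_lt0 F : degree_lt 0 F -> F = 0.
Proof.
move=> F0; apply/matrixP => i j; rewrite mxE; apply/eqP.
by rewrite -size_poly_leq0 F0.
Qed.

Lemma degree_ltD d F G : degree_lt d F -> degree_lt d G -> degree_lt d (F + G).
Proof.
by move=> Fd Gd i j; rewrite mxE (leq_trans (size_polyD _ _)) // geq_max Fd Gd.
Qed.

Lemma degree_lt_mulC d c F : degree_lt d F -> degree_lt d (map_mx polyC c *m F).
Proof.
move=> Fd i j; rewrite mxE (leq_trans (size_sum _ _ _)) //.
apply/bigmax_leqP => k _.
by rewrite mxE mul_polyC (leq_trans (size_scale_leq _ _)).
Qed.

Lemma degree_ltW d e F : (d <= e)%N -> degree_lt d F -> degree_lt e F.
Proof. by move=> de Fd i j; exact: leq_trans (Fd i j) de. Qed.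

Lemma exists_degree F : exists d, degree_lt d F.
Proof.
exists (\max_(p : 'I_n.+1 * 'I_n.+1) size (F p.1 p.2)) => i j.
exact: (leq_bigmax (i, j)).
Qed.

Lemma mx_poly_ind (Q : M -> Prop) :
  Q 0 -> (forall c F, Q F -> Q (map_mx polyC c + 'X *: F)) -> forall F, Q F.
Proof.
move=> Q0 QS F; have [d] := exists_degree F; elim: d F => [F /degree_lt0->//|d IH F Fd].
have -> : F = map_mx polyC (map_mx (coefp 0) F) + 'X *: map_mx (drop_poly 1) F.
  apply/matrixP => i j; rewrite !mxE /=; apply/polyP => k.
  rewrite coefD coefC coefXM coef_drop_poly addn1.
  by case: k => [|k]; rewrite ?addr0 ?add0r.
apply/QS/IH => i j; rewrite mxE size_drop_poly leq_subLR add1n; exact: Fd.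
Qed.

Definition commX T F : M := 'X *: T F - T ('X *: F).

Definition left_linear T : Prop := (forall F G, T (F + G) = T F + T G) /\
  (forall c F, T (map_mx polyC c *m F) = map_mx polyC c *m T F).

Lemma dact0l D : dact 0 D = 0.
Proof. by apply: (addrI (dact 0 D)); rewrite -dactDl !addr0. Qed.

Lemma dactNr F D : dact F (- D) = - dact F D.
Proof. by rewrite -sub0r dactBr dact0r sub0r. Qed.

Lemma dermxX F : dermx ('X *: F) = 'X *: dermx F + F.
Proof.
apply/matrixP => i j; rewrite !mxE derivM derivX mul1r addrC //.
Qed.

Lemma iter_dermxX k F :
  iter k dermx ('X *: F) = 'X *: iter k dermx F + (iter k.-1 dermx F) *+ k.
Proof.
elim: k => [|k IH]; first by rewrite mulr0n addr0.
rewrite iterS IH dermxD dermxX -addrA; congr (_ + _).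
have dermxMn G m : dermx (G *+ m) = dermx G *+ m.
  by elim: m => [|m IHm]; rewrite ?dermx0 // !mulrS dermxD IHm.
by rewrite dermxMn mulrS; case: k {IH}.
Qed.

(** Commutation with [x] is formal differentiation with respect to the variable
    of [D], which stands for the derivation. *)
Lemma dactX F D : dact ('X *: F) D = 'X *: dact F D + dact F D^`().
Proof.
have D'm : (size D^`() <= size D)%N by rewrite (leq_trans (size_deriv_leq D)) // leq_pred.
rewrite /dact.
under eq_bigr => j _ do rewrite iter_dermxX mulmxDl -scalemxAl.
rewrite big_split /= -scaler_sumr; congr (_ + _); rewrite -/(dact _ _).
rewrite (dactE F D'm); case Dm: (size D) => [|m]; first by rewrite !big_ord0.
rewrite big_ord_recl mulr0n mul0mx add0r [RHS]big_ord_recr /=.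
rewrite [X in _ = _ + _ *m X](_ : _ = 0) ?mulmx0 ?addr0; last first.
  by rewrite coef_deriv nth_default ?mul0rn // Dm.
by apply: eq_bigr => j _; rewrite /= coef_deriv -!scaler_nat -scalemxAl -scalemxAr.
Qed.

Lemma antiderivative E : exists D, D^`() = E.
Proof.
exists (\poly_(i < (size E).+1) ((i%:R^-1 : K)%:P *: E`_i.-1)).
apply/polyP => i; rewrite coef_deriv coef_poly ltnS.
case: ltnP => [_|Ei]; last by rewrite nth_default // mul0rn.
by rewrite -scaler_nat scalerA -polyC_natr -polyCM divff ?scale1r ?pnatr_eq0.
Qed.

Lemma commX_left_linear T : left_linear T -> left_linear (commX T).
Proof.
case=> TD TC; split=> [F G|c F]; rewrite /commX.
  by rewrite scalerDr !TD scalerDr opprD addrACA.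
by rewrite mulmxBr -scalemxAr -[_ *m T ('X *: F)]TC -scalemxAr TC.
Qed.

(** Integrating the commutator, which is a differential operator by induction,
    leaves a left linear operator that commutes with [x]; it is the right
    multiplication by its value at 1. *)
Lemma operator_of_commX k T : left_linear T ->
  (forall F, iter k commX T F = 0) -> exists D, forall F, T F = dact F D.
Proof.
elim: k T => [|k IH] T Tl Tk; first by exists 0 => F; rewrite dact0r; exact: Tk.
have [|E TE] := IH (commX T) (commX_left_linear Tl).
  by move=> F; rewrite -iterSr.
have [D DE] := antiderivative (- E); pose B := T 1 - dact 1 D.
have [TD TC] := Tl.
exists (D + B%:P) => F; rewrite dactDr.
have -> : dact F B%:P = F *m B.
  by rewrite (dactE F (size_polyC_leq1 B)) big_ord1 coefC.
have constE c : map_mx polyC c = map_mx polyC c *m 1 :> M by rewrite mulmx1.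
elim/mx_poly_ind: F => [|c F IHF].
  rewrite mul0mx dact0l addr0; apply: (addrI (T 0)).
  by rewrite -TD !addr0.
have TX : T ('X *: F) = 'X *: T F - dact F E.
  by rewrite -TE /commX opprB addrC subrK.
have DX : dact ('X *: F) D = 'X *: dact F D - dact F E.
  by rewrite dactX DE dactNr.
rewrite TD dactDl TX DX [map_mx polyC c in LHS](constE c).
rewrite [X in _ = dact X D + _ + _]constE.
rewrite TC dact_mulCl IHF mulmxDl -scalemxAl scalerDr.
have -> : T 1 = dact 1 D + B by rewrite addrC subrK.
rewrite mulmxDr -!addrA; congr (_ + _).
by rewrite [LHS]addrCA; congr (_ + _); rewrite addrA addrC.
Qed.

Lemma commX_dact D : commX (fun G => dact G D) = (fun G => dact G (- D^`())).
Proof. by apply/funext => F; rewrite /commX dactX dactNr opprD addrA subrr add0r. Qed.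

Lemma iter_commX_dact D k : (size D <= k)%N -> forall F,
  iter k commX (fun G => dact G D) F = 0.
Proof.
elim: k D => [|k IH] D Dk F.
  by move: Dk; rewrite leqn0 size_poly_eq0 => /eqP->; rewrite /= dact0r.
rewrite iterSr commX_dact IH // size_polyN (leq_trans (size_deriv_leq D)) //.
by rewrite -subn1 leq_subLR add1n.
Qed.

End OperatorsAndX.

(** * Adjoints for inner products of matrix polynomials *)

Section ConjugateTranspose.
Local Open Scope sesquilinear_scope.
Variable C : numClosedFieldType.

Lemma adjmxM m n p (A : 'M[C]_(m, n)) (B : 'M[C]_(n, p)) :
  (A *m B)^t* = B^t* *m A^t*.
Proof. by rewrite trmx_mul map_mxM. Qed.

Lemma adjmxK m n (A : 'M[C]_(m, n)) : A^t*^t* = A.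
Proof. by apply/matrixP => i j; rewrite !mxE conjCK. Qed.

Lemma adjmxE m n (A : 'M[C]_(m, n)) i j : (A^t*) i j = Num.conj (A j i).
Proof. by rewrite !mxE. Qed.

Lemma adjmxZ m n a (A : 'M[C]_(m, n)) : (a *: A)^t* = Num.conj a *: A^t*.
Proof. by apply/matrixP => i j; rewrite !mxE rmorphM. Qed.

Lemma adjmxD m n (A B : 'M[C]_(m, n)) : (A + B)^t* = A^t* + B^t*.
Proof. by rewrite raddfD map_mxD. Qed.

Lemma adjmx0 m n : (0 : 'M[C]_(m, n))^t* = 0.
Proof. by rewrite trmx0 map_mx0. Qed.

Definition posdefmx n (H : 'M[C]_n) :=
  forall u : 'rV[C]_n, u != 0 -> 0 < (u *m H *m u^t*) 0 0.

Lemma posdefmx_unit n (H : 'M[C]_n) : posdefmx H -> H \in unitmx.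
Proof.
move=> Hp; rewrite -row_free_unit; apply: inj_row_free => u uH.
by apply: contraTeq isT => /Hp; rewrite uH mul0mx mxE ltxx.
Qed.

Lemma posdefmx_eq0 m n (H : 'M[C]_n) (X : 'M[C]_(m, n)) :
  posdefmx H -> X *m H *m X^t* = 0 -> X = 0.
Proof.
move=> Hp XHX; apply/row_matrixP => i; rewrite row0.
apply: contraTeq isT => /Hp; rewrite rowE adjmxM mulmxA.
by rewrite -(mulmxA _ X) -(mulmxA _ (X *m H)) XHX mulmx0 mul0mx mxE ltxx.
Qed.

(** Positivity of the involution [X |-> H *m X^t* *m invmx H]: for the hermitian
    matrix [S = X *m H *m X^t*] the hypothesis gives [S *m invmx H *m S = 0], and
    definiteness applies twice. *)
Lemma posdefmx_sandwich n (H X : 'M[C]_n) : posdefmx H -> H^t* = H ->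
  X *m (H *m X^t* *m invmx H) *m X = 0 -> X = 0.
Proof.
move=> Hp Hh XX; have Hu := posdefmx_unit Hp.
have HVh : (invmx H)^t* = invmx H by rewrite -[in RHS]Hh trmx_inv map_invmx.
pose S := X *m H *m X^t*.
have Sh : S^t* = S by rewrite /S !adjmxM adjmxK Hh mulmxA.
apply: (posdefmx_eq0 Hp); rewrite -/S.
have : S *m invmx H = 0.
  apply: (posdefmx_eq0 Hp); rewrite mulmxKV // adjmxM HVh Sh mulmxA /S.
  have := congr1 (fun Y => Y *m H *m X^t*) XX; rewrite !mul0mx => XX'.
  by rewrite -[RHS]XX' !mulmxA.
by move/(congr1 (fun Y => Y *m H)); rewrite mulmxKV // mul0mx.
Qed.
End ConjugateTranspose.

Section Form.
Local Open Scope sesquilinear_scope.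
Variables (R : realType) (n : nat).
Local Notation C := R[i].
Local Notation M := 'M[{poly C}]_n.+1.
Implicit Types (F G H : M) (c : 'M[C]_n.+1).

Record polynomial_inner_product (ip : M -> M -> 'M[C]_n.+1) : Prop :=
  PolynomialInnerProduct {
  ipDl : forall F G H, ip (F + G) H = ip F H + ip G H;
  ipCl : forall c F G, ip (map_mx polyC c *m F) G = c *m ip F G;
  ipX : forall F G, ip ('X *: F) G = ip F ('X *: G);
  ip_herm : forall F G, ip G F = (ip F G)^t*;
  ip_pos : forall F (u : 'rV[C]_n.+1), map_mx polyC u *m F != 0 ->
    0 < (u *m ip F F *m u^t*) 0 0 }.

Variable ip : M -> M -> 'M[C]_n.+1.
Hypothesis ipP : polynomial_inner_product ip.

Lemma ipDr F G H : ip F (G + H) = ip F G + ip F H.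
Proof. by rewrite ip_herm // ipDl // adjmxD -!ip_herm. Qed.

Lemma ipCr c F G : ip F (map_mx polyC c *m G) = ip F G *m c^t*.
Proof. by rewrite ip_herm // ipCl // adjmxM -ip_herm. Qed.

Lemma ip0l G : ip 0 G = 0.
Proof. by apply: (addrI (ip 0 G)); rewrite -ipDl // !addr0. Qed.

Lemma ip0r G : ip G 0 = 0.
Proof. by rewrite ip_herm // ip0l adjmx0. Qed.

Lemma ipNl F G : ip (- F) G = - ip F G.
Proof. by apply: (addrI (ip F G)); rewrite -ipDl // !subrr ip0l. Qed.

Lemma ipNr F G : ip F (- G) = - ip F G.
Proof. by apply: (addrI (ip F G)); rewrite -ipDr // !subrr ip0r. Qed.

Lemma ip_nondegenerate G : (forall F, ip F G = 0) -> G = 0.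
Proof.
move=> G0; apply: contraTeq isT => Gn0.
have [i ri] : exists i, row i G != 0.
  apply: contrapT => /forallNP r0; move/eqP: Gn0; apply; apply/row_matrixP => i.
  by rewrite row0; apply/eqP/negPn/negP/r0.
have := ip_pos ipP (F := G) (u := delta_mx 0 i).
by rewrite map_delta_mx -rowE G0 mulmx0 mul0mx mxE ltxx => /(_ ri).
Qed.

Lemma ip_herm_diag F : (ip F F)^t* = ip F F.
Proof. by rewrite -ip_herm. Qed.

Lemma monic_mul_neq0 d F (u : 'rV[C]_n.+1) : monic_degree d F -> u != 0 ->
  map_mx polyC u *m F != 0.
Proof.
case=> _ Fd; apply: contraNneq => /matrixP uF; apply/eqP.
rewrite -[u]mulmx1 -Fd; apply/matrixP => i j.
have := congr1 (fun p : {poly C} => p`_d) (uF i j).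
rewrite !mxE coef0 coef_sum => e; rewrite -[RHS]e.
by apply: eq_bigr => k _; rewrite !mxE coefCM.
Qed.

Lemma ip_monic_posdef d F : monic_degree d F -> posdefmx (ip F F).
Proof. by move=> Fd u u0; apply: ip_pos => //; exact: monic_mul_neq0 Fd u0. Qed.

Lemma map_coefp_mulC d c F :
  map_mx (coefp d) (map_mx polyC c *m F) = c *m map_mx (coefp d) F.
Proof.
apply/matrixP => i j; rewrite !mxE /= coef_sum.
by apply: eq_bigr => k _; rewrite !mxE coefCM.
Qed.

Lemma map_coefp_lt d F : degree_lt d F -> map_mx (coefp d) F = 0.
Proof. by move=> Fd; apply/matrixP => i j; rewrite !mxE /= nth_default. Qed.

Lemma degree_lt_split d F P : monic_degree d P -> degree_lt d.+1 F ->
  exists2 c, degree_lt d (F - map_mx polyC c *m P) & c = map_mx (coefp d) F.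
Proof.
move=> [Pd P1] Fd; exists (map_mx (coefp d) F) => // i j.
apply/leq_sizeP => k; rewrite leq_eqVlt => /orP[/eqP <-|dk].
  have /matrixP/(_ i j) : map_mx (coefp d) F *m map_mx (coefp d) P = map_mx (coefp d) F.
    by rewrite P1 mulmx1.
  rewrite !mxE coefB coef_sum /= => <-; apply/eqP; rewrite subr_eq0; apply/eqP.
  by apply: eq_bigr => l _; rewrite !mxE coefCM.
rewrite !mxE coefB coef_sum nth_default ?(leq_trans (Fd i j)) // big1 ?subr0 //.
by move=> l _; rewrite !mxE coefCM nth_default ?mulr0 // (leq_trans (Pd l j)).
Qed.

Lemma monic_sub_low d G : degree_lt d G -> monic_degree d (('X^d)%:M - G : M).
Proof.
move=> Gd; split=> [i j|].
  rewrite !mxE (leq_trans (size_polyD _ _)) // size_polyN geq_max.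
  rewrite (leq_trans (Gd i j)) // andbT.
  by case: (i == j); rewrite ?mulr1n ?mulr0n ?size_polyXn ?size_poly0.
apply/matrixP => i j; rewrite !mxE /= coefB [X in _ - X]nth_default ?subr0 //.
by case: (i == j); rewrite ?mulr1n ?mulr0n ?coefXn ?eqxx ?coef0.
Qed.

(** Gram-Schmidt: the projection of [F] onto degree at most [d] is its projection
    onto smaller degrees plus a multiple of the monic orthogonal polynomial of
    degree [d], itself obtained by projecting [x ^+ d]. *)
Lemma orthogonal_projection d F : exists2 G, degree_lt d G &
  forall H, degree_lt d H -> ip (F - G) H = 0.
Proof.
elim: d F => [|d IH] F.
  exists 0; first by move=> i j; rewrite mxE size_poly0.
  by move=> H /degree_lt0->; rewrite ip0r.
pose X := ('X^d)%:M : M; have [G Gd GX] := IH X.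
have Pm : monic_degree d (X - G) by exact: monic_sub_low.
have [G1 G1d G1F] := IH F; set P := X - G in Pm GX.
have Pu := posdefmx_unit (ip_monic_posdef Pm).
pose c := ip (F - G1) P *m invmx (ip P P).
exists (G1 + map_mx polyC c *m P).
  apply: degree_ltD; first exact: degree_ltW G1d.
  by apply: degree_lt_mulC; case: Pm.
move=> H Hd; have [e He _] := degree_lt_split Pm Hd.
have e1 := G1F _ He; have e2 := GX _ He.
rewrite -[H](subrK (map_mx polyC e *m P)).
have ipE K : ip (F - (G1 + map_mx polyC c *m P)) K =
    ip (F - G1) K - c *m ip P K.
  by rewrite opprD addrA [LHS](ipDl ipP) ipNl (ipCl ipP).
move: (H - _) e1 e2 => H' e1 e2; rewrite ipDr ipCr !ipE e1 e2 mulmx0 subrr add0r.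
by rewrite mulmxKV // subrr mul0mx.
Qed.

Lemma exists_monic_orthogonal : exists P : nat -> M,
  (forall d, monic_degree d (P d)) /\ (forall d e, e != d -> ip (P d) (P e) = 0).
Proof.
have [|P PP] := @choice nat M (fun d P => monic_degree d P /\
    forall H, degree_lt d H -> ip P H = 0).
  move=> d; have [G Gd GX] := orthogonal_projection d ('X^d)%:M.
  exists (('X^d)%:M - G); split=> //.
  exact: monic_sub_low.
exists P; split=> [d|d e]; first by case: (PP d).
rewrite neq_ltn => /orP[ed|de].
  by apply: (PP d).2; apply: degree_ltW ed _; case: (PP e) => -[].
rewrite ip_herm //.
rewrite (PP e).2 ?adjmx0 //; apply: degree_ltW de _; by case: (PP d) => -[].
Qed.
Section OrthogonalSequence.
Local Open Scope sesquilinear_scope.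
Variable P : nat -> M.
Hypothesis Pmonic : forall d, monic_degree d (P d).
Hypothesis Portho : forall d e, e != d -> ip (P d) (P e) = 0.
Local Notation norm d := (ip (P d) (P d)).

Lemma norm_unit d : norm d \in unitmx.
Proof. exact: posdefmx_unit (ip_monic_posdef (Pmonic d)). Qed.

Lemma orthogonal_ind_lt d (Q : M -> Prop) : Q 0 ->
  (forall c e F, (e < d)%N -> Q F -> Q (map_mx polyC c *m P e + F)) ->
  forall F, degree_lt d F -> Q F.
Proof.
elim: d => [|d IH] Q0 QS F Fd; first by rewrite (degree_lt0 Fd).
have [c Fc _] := degree_lt_split (Pmonic d) Fd.
rewrite -[F](subrK (map_mx polyC c *m P d)) addrC; apply: (QS) => //.
by apply: IH Fc => // c' e G ed; apply: QS; exact: ltnW.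
Qed.

Lemma orthogonal_ind (Q : M -> Prop) : Q 0 ->
  (forall c e F, Q F -> Q (map_mx polyC c *m P e + F)) -> forall F, Q F.
Proof.
move=> Q0 QS F; have [d Fd] := exists_degree F.
by apply: (orthogonal_ind_lt Q0 _ Fd) => c e G _; exact: QS.
Qed.

Lemma ip_orthogonal_lt d F : degree_lt d F -> ip F (P d) = 0.
Proof.
move: F; apply: orthogonal_ind_lt => [|c e F ed IH]; first exact: ip0l.
by rewrite (ipDl ipP) IH addr0 (ipCl ipP) Portho ?mulmx0 // gtn_eqF.
Qed.

Lemma sum_stable (V : nmodType) (f : nat -> V) m m' :
  (forall e, (m <= e)%N -> f e = 0) -> (m <= m')%N ->
  \sum_(e < m') f e = \sum_(e < m) f e.
Proof.
move=> f0 mm; rewrite -(subnKC mm) big_split_ord /= [X in _ + X]big1 ?addr0 //.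
by move=> e _; rewrite f0 // leq_addr.
Qed.

(** The polynomials [P d] form a basis over the constant matrices, and the
    coefficient of [F] at [P e] is [ip F (P e) *m invmx (norm e)], which is zero
    when [e] exceeds the degree of [F]. *)
Lemma diagonal_operator (L : nat -> 'M[C]_n.+1) :
  exists2 T : M -> M, left_linear T &
    forall d, T (P d) = map_mx polyC (L d) *m P d.
Proof.
pose term F e : M := map_mx polyC (ip F (P e) *m invmx (norm e) *m L e) *m P e.
pose deg F := sval (cid (exists_degree F)).
pose T F := \sum_(e < deg F) term F e.
have term0 F d e : degree_lt d F -> (d <= e)%N -> term F e = 0.
  move=> Fd de; rewrite /term ip_orthogonal_lt ?mul0mx ?map_mx0 ?mul0mx //.
  exact: degree_ltW Fd.
have TE m F : degree_lt m F -> T F = \sum_(e < m) term F e.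
  move=> Fm; have Fd : degree_lt (deg F) F := svalP (cid (exists_degree F)).
  have [le|/ltnW le] := leqP m (deg F).
    by apply: sum_stable le => e; exact: term0.
  by apply/esym/sum_stable => // e; exact: term0.
exists T.
- split=> [F G|c F].
    have [d Fd] := exists_degree F; have [e Ge] := exists_degree G.
    have Fm := degree_ltW (leq_maxl d e) Fd; have Gm := degree_ltW (leq_maxr d e) Ge.
    rewrite (TE _ _ (degree_ltD Fm Gm)) (TE _ _ Fm) (TE _ _ Gm) -big_split.
    by apply: eq_bigr => i _; rewrite /term (ipDl ipP) !mulmxDl map_mxD mulmxDl.
  have [d Fd] := exists_degree F.
  rewrite (TE _ _ (degree_lt_mulC c Fd)) (TE _ _ Fd) mulmx_sumr.
  by apply: eq_bigr => i _; rewrite /term (ipCl ipP) -!mulmxA !map_mxM -!mulmxA.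
- move=> d; rewrite (TE d.+1); last exact: (Pmonic d).1.
  rewrite big_ord_recr /= big1 ?add0r => [|e _].
    by rewrite /term mulmxV ?norm_unit // mul1mx.
  by rewrite /term Portho ?mul0mx ?map_mx0 ?mul0mx // ltn_eqF.
Qed.

Lemma adjoint_commX T T' : (forall F G, ip (T F) G = ip F (T' G)) ->
  forall F G, ip (commX T F) G = ip F (- commX T' G).
Proof.
move=> TT F G; rewrite /commX opprB ipDr ipDl // ipNl ipNr.
by rewrite (ipX ipP) !TT (ipX ipP) addrC.
Qed.

Lemma commXN T F : commX (fun G => - T G) F = - commX T F.
Proof. by rewrite /commX opprB scalerN opprK addrC. Qed.

Lemma iter_commXN k T F : iter k (@commX _ _) (fun G => - T G) F =
  - iter k (@commX _ _) T F.
Proof.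
elim: k T F => // k IH T F; rewrite !iterSr -IH; congr (iter k _ _ F).
by apply/funext => G; exact: commXN.
Qed.

(** Adjunction exchanges commutation with [x] and its opposite, as [x] is
    symmetric. *)
Lemma adjoint_iter_commX k T T' : (forall F G, ip (T F) G = ip F (T' G)) ->
  (forall F, iter k (@commX _ _) T F = 0) ->
  forall F, iter k (@commX _ _) T' F = 0.
Proof.
elim: k T T' => [|k IH] T T' TT T0 G.
  apply: ip_nondegenerate => F; rewrite /= -TT.
  by have /= -> := T0 F; rewrite ip0l.
have := IH _ _ (adjoint_commX TT); rewrite -iterSr => /(_ T0 G).
by rewrite iter_commXN iterSr => /eqP; rewrite oppr_eq0 => /eqP.
Qed.

(** An operator that is diagonal in the basis [P d] has a formal adjoint, diagonal
    in the same basis.  If the operator is differential then an iterated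
    commutator with [x] vanishes, hence so does that of the adjoint, which is
    therefore differential too. *)
Lemma adjoint_operator (L : nat -> 'M[C]_n.+1) (D : {poly M}) :
  (forall d, dact (P d) D = map_mx polyC (L d) *m P d) ->
  exists E : {poly M}, forall d, dact (P d) E =
    map_mx polyC (norm d *m (L d)^t* *m invmx (norm d)) *m P d.
Proof.
move=> DL.
have [T [TD TC] TP] := diagonal_operator
  (fun d => norm d *m (L d)^t* *m invmx (norm d)).
have TT F G : ip (dact F D) G = ip F (T G).
  elim/orthogonal_ind: F => [|c d F IH].
    by rewrite dact0l !ip0l.
  rewrite dactDl dact_mulCl !(ipDl ipP) !(ipCl ipP) IH; congr (_ *m _ + _).
  rewrite DL (ipCl ipP); elim/orthogonal_ind: G {IH} => [|c' e G IH].
    by have := TC 0 0; rewrite map_mx0 !mul0mx => ->; rewrite !ip0r mulmx0.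
  rewrite TD TC !ipDr mulmxDr IH !ipCr TP ipCr mulmxA; congr (_ *m _ + _).
  have [->|ed] := eqVneq e d; last by rewrite Portho // mulmx0 mul0mx.
  rewrite !adjmxM adjmxK ip_herm_diag trmx_inv map_invmx ip_herm_diag.
  by rewrite mulKVmx ?norm_unit.
have [|E TE] := operator_of_commX (conj TD TC) (k := size D).
  by apply: (adjoint_iter_commX TT); exact: iter_commX_dact.
by exists E => d; rewrite -TE.
Qed.
End OrthogonalSequence.
End Form.

(** * The embedding into matrices over C[t] *)

Section Symbol.
Local Open Scope sesquilinear_scope.
Variables (K : numFieldType) (n : nat).
Local Notation M := 'M[{poly K}]_n.+1.

Definition ffact_poly j : {poly K} := \prod_(i < j) ('X - i%:R%:P).

Lemma horner_ffact_poly d j : (ffact_poly j).[d%:R] = (d ^_ j)%:R.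
Proof.
rewrite /ffact_poly; elim: j => [|j IH]; first by rewrite big_ord0 hornerC.
rewrite big_ord_recr /= hornerM IH hornerXsubC ffactnSr natrM.
have [jd|dj] := leqP j d; first by rewrite natrB.
by rewrite ffact_small // !mul0r.
Qed.

(** Applied to [x ^+ d], the term of order [j] of [D] contributes to the
    coefficient of [x ^+ d] only through its coefficient of [x ^+ j], with the
    factor [d ^_ j], a polynomial in [d].  If [D] does not raise degrees, then
    [symbol D] at [d] is thus its leading coefficient on degree [d]. *)
Definition symbol (D : {poly M}) : M :=
  \sum_(j < size D) ffact_poly j *: map_mx polyC (map_mx (coefp j) D`_j).

Definition eval_at (d : nat) (X : M) : 'M[K]_n.+1 := map_mx (horner_eval d%:R) X.

Lemma eval_atM d X Y : eval_at d (X * Y) = eval_at d X *m eval_at d Y.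
Proof. exact: map_mxM. Qed.

Lemma eval_at_inj X Y : (forall d, eval_at d X = eval_at d Y) -> X = Y.
Proof.
move=> XY; apply/matrixP => i j; apply/eqP; rewrite -subr_eq0; apply/negPn/negP => p0.
pose rs : seq K := [seq k%:R | k <- iota 0 (size (X i j - Y i j))].
have := max_poly_roots p0 (rs := rs); rewrite size_map size_iota ltnn.
suff [-> ->] : all (root (X i j - Y i j)) rs /\ uniq rs by move=> /(_ isT isT).
split; last first.
  by rewrite map_inj_uniq ?iota_uniq // => k l /eqP; rewrite eqr_nat => /eqP.
apply/allP => _ /mapP[k _ ->]; apply/rootP; rewrite hornerD hornerN.
by have /matrixP/(_ i j) := XY k; rewrite !mxE /horner_eval => ->; rewrite subrr.
Qed.

Lemma leading_coef_dact d (D : {poly M}) :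
  map_mx (coefp d) (dact ('X^d)%:M D) = eval_at d (symbol D).
Proof.
rewrite /eval_at /symbol /dact !map_mx_sum; apply: eq_bigr => j _.
rewrite iter_dermx_scalar derivnXn mul_scalar_mx; apply/matrixP => i k.
rewrite !mxE /= /horner_eval hornerM hornerC horner_ffact_poly.
rewrite mulrnAl coefMn coefXnM ltnNge leq_subr /= mulr_natl.
have [jd|dj] := leqP j d; first by rewrite subKn.
by rewrite ffact_small // !mulr0n.
Qed.
End Symbol.

Section Bispectral.
Local Open Scope sesquilinear_scope.
Variables (R : realType) (n : nat) (W : R -> 'M[R[i]]_n.+1).
Hypothesis ipP : polynomial_inner_product (inner W).
Local Notation C := R[i].
Local Notation P := (monic_ops W).
Local Notation A := (bispectral_algebra W).

Lemma monic_opsP : monic_orthogonal W P.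
Proof. exact: (xgetPex (fun=> 0) (exists_monic_orthogonal ipP)). Qed.

(** Polynomials of degree less than [d] are combinations of the first [d]
    orthogonal polynomials, each of which is an eigenvector. *)
Lemma degree_preserving (D : {poly 'M[{poly C}]_n.+1}) (L : nat -> 'M[C]_n.+1) :
  (forall d, dact (P d) D = map_mx polyC (L d) *m P d) ->
  forall d F, degree_lt d F -> degree_lt d (dact F D).
Proof.
move=> DL d; apply: (orthogonal_ind_lt monic_opsP.1) => [|c e F ed IH].
  by rewrite dact0l => i j; rewrite mxE size_poly0.
rewrite dactDl dact_mulCl DL; apply: degree_ltD => //.
do 2!apply: degree_lt_mulC; apply: degree_ltW ed _; exact: (monic_opsP.1 e).1.
Qed.

Lemma eval_symbol (D : {poly 'M[{poly C}]_n.+1}) (L : nat -> 'M[C]_n.+1) :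
  (forall d, dact (P d) D = map_mx polyC (L d) *m P d) ->
  forall d, eval_at d (symbol D) = L d.
Proof.
move=> DL d; rewrite -leading_coef_dact.
have Xm := monic_sub_low (n := n) (R := R) (d := d) (G := 0).
have {Xm} [|Xd X1] := Xm; first by move=> i j; rewrite mxE size_poly0.
rewrite subr0 in Xd X1.
have [c Gd cE] := degree_lt_split (monic_opsP.1 d) Xd.
move: Gd; rewrite cE X1 map_mx1 mul1mx => Gd.
rewrite -[X in dact X D](subrK (P d)) dactDl map_mxD DL map_coefp_mulC.
rewrite (monic_opsP.1 d).2 mulmx1 map_coefp_lt ?add0r //.
exact: (degree_preserving DL).
Qed.

Lemma eigenvalues (D : A) : exists L : nat -> 'M[C]_n.+1,
  forall d, dact (P d) (val D) = map_mx polyC (L d) *m P d.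
Proof. exact/bispectralP/(valP D). Qed.

Lemma dact_symbol (D : A) d :
  dact (P d) (val D) = map_mx polyC (eval_at d (symbol (val D))) *m P d.
Proof. by have [L DL] := eigenvalues D; rewrite DL (eval_symbol DL). Qed.

Definition symbol_of (D : A) := symbol (val D).

Lemma symbol_zmod_morphism : zmod_morphism symbol_of.
Proof.
move=> D E; apply: eval_at_inj => d; rewrite [RHS]map_mxB.
pose L d := eval_at d (symbol_of D) - eval_at d (symbol_of E).
rewrite -[RHS]/(L d); move: d; apply: eval_symbol => d.
by rewrite rmorphB dactBr !dact_symbol /L map_mxB mulmxBl.
Qed.

Lemma symbol_monoid_morphism : monoid_morphism symbol_of.
Proof.
split.
  apply: eval_at_inj => d; rewrite /eval_at map_mx1.
  rewrite -[RHS]/((fun=> 1%:M) d); move: d; apply: eval_symbol => d.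
  by rewrite map_mx1 mul1mx rmorph1; exact: dact1.
move=> D E; apply: eval_at_inj => d; rewrite eval_atM.
pose L d := eval_at d (symbol_of D) *m eval_at d (symbol_of E).
rewrite -[RHS]/(L d); move: d; apply: eval_symbol => d.
by rewrite rmorphM dactM dact_symbol dact_mulCl dact_symbol map_mxM mulmxA.
Qed.

HB.instance Definition _ := GRing.isZmodMorphism.Build A 'M[{poly C}]_n.+1
  symbol_of symbol_zmod_morphism.
HB.instance Definition _ := GRing.isMonoidMorphism.Build A 'M[{poly C}]_n.+1
  symbol_of symbol_monoid_morphism.

Lemma symbol_inj : injective symbol_of.
Proof.
move=> D E DE; apply/val_inj/dact_ext.
apply: (orthogonal_ind monic_opsP.1) => [|c d F IH]; first by rewrite !dact0l.
rewrite !dactDl !dact_mulCl IH !dact_symbol.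
by rewrite -!/(symbol_of _) DE.
Qed.

Lemma symbol_const (c : C) : exists D : A, symbol_of D = c%:P%:M.
Proof.
pose B : diffop C n := (c%:P%:M)%:P.
have BL d : dact (P d) B = map_mx polyC (c%:M) *m P d.
  rewrite (dactE (P d) (size_polyC_leq1 _)) big_ord1 coefC /= map_scalar_mx.
  by rewrite mul_mx_scalar mul_scalar_mx.
have BW : B \in bispectral W by apply/bispectralP; exists (fun=> c%:M).
exists (BispectralAlgebra BW); apply: eval_at_inj => d.
rewrite (eval_symbol BL) /eval_at map_scalar_mx /= /horner_eval hornerC //.
Qed.

Lemma symbol_embedding : exists Lam : {rmorphism A -> 'M[{poly C}]_n.+1},
  injective Lam /\ forall c, exists D, Lam D = c%:P%:M.
Proof. by exists symbol_of; split; [exact: symbol_inj | exact: symbol_const]. Qed.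

(** Take for [E] the adjoint of [D]: in each degree the eigenvalue of
    [D * E * D] is of the form treated in [posdefmx_sandwich]. *)
Lemma bispectral_semiprime (D : A) : D != 0 -> exists E : A, D * E * D != 0.
Proof.
move=> D0; have [E DE] := adjoint_operator ipP monic_opsP.1 monic_opsP.2 (dact_symbol D).
have EW : (E : diffop C n) \in bispectral W.
  by apply/bispectralP; eexists; exact: DE.
exists (BispectralAlgebra EW); apply: contraNneq D0 => DED.
apply/eqP/symbol_inj; rewrite rmorph0; apply: eval_at_inj => d.
rewrite [RHS]map_mx0.
apply: (posdefmx_sandwich (ip_monic_posdef ipP (monic_opsP.1 d))).
  by rewrite ip_herm_diag.
have := congr1 (fun X => eval_at d (symbol_of X)) DED.
rewrite !rmorphM rmorph0 !eval_atM [RHS]map_mx0 => <-.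
by congr (_ *m _ *m _); rewrite (eval_symbol DE).
Qed.
End Bispectral.

Theorem bispectral_algebra_structure (R : realType) (W : R -> 'M[R[i]]_2) :
  polynomial_inner_product (inner W) ->
  (exists D E : bispectral_algebra W, D * E <> E * D) ->
  full (bispectral_algebra W) 2 /\
  is_field (total_fractions (ring_center (bispectral_algebra W))) /\
  exists phi : {rmorphism central_loc (bispectral_algebra W) ->
                 'M[total_fractions (ring_center (bispectral_algebra W))]_2},
    [/\ bijective phi,
        forall x : total_fractions (ring_center (bispectral_algebra W)),
          phi (tens _ 1 x) = x%:M,
        injective (fun D : bispectral_algebra W => phi (tens _ D 1))
      & is_order (to_loc (@nonzerodiv (ring_center (bispectral_algebra W))))
          [set phi (tens _ D 1) | D in [set: bispectral_algebra W]]].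
Proof.
move=> ipP hnc.
have [Lam [Lam_inj Lam_const]] := symbol_embedding ipP.
apply: (matrix_algebra_structure _ Lam_inj Lam_const hnc).
  by rewrite pnatr_eq0.
exact: bispectral_semiprime.
Qed.

(** * The inner product of a weight matrix *)

Section ComplexIntegral.
Local Open Scope complex_scope.
Local Open Scope sesquilinear_scope.
Variable R : realType.
Local Notation C := R[i].
Local Notation mu := (@lebesgue_measure R).
Implicit Types f g : R -> C.

Definition cintegrable f : Prop :=
  mu.-integrable setT (fun x : measurableTypeR R => (complex.Re (f x))%:E) /\
  mu.-integrable setT (fun x : measurableTypeR R => (complex.Im (f x))%:E).

Lemma ReD (a b : C) : complex.Re (a + b) = complex.Re a + complex.Re b.
Proof. by case: a b => [? ?] []. Qed.
Lemma ImD (a b : C) : complex.Im (a + b) = complex.Im a + complex.Im b.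
Proof. by case: a b => [? ?] []. Qed.
Lemma ReM (a b : C) : complex.Re (a * b) =
  complex.Re a * complex.Re b - complex.Im a * complex.Im b.
Proof. by case: a b => [? ?] []. Qed.
Lemma ImM (a b : C) : complex.Im (a * b) =
  complex.Re a * complex.Im b + complex.Im a * complex.Re b.
Proof. by case: a b => [? ?] []. Qed.
Lemma ReJ (a : C) : complex.Re (Num.conj a) = complex.Re a.
Proof. by case: a. Qed.
Lemma ImJ (a : C) : complex.Im (Num.conj a) = - complex.Im a.
Proof. by case: a. Qed.

Lemma complex_ext (a b : C) :
  complex.Re a = complex.Re b -> complex.Im a = complex.Im b -> a = b.
Proof. by case: a b => [? ?] [? ?] /= -> ->. Qed.

Local Notation int f := (mu.-integrable setT (EFin \o (f : measurableTypeR R -> R))).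

Lemma intD (f g : R -> R) : int f -> int g -> int (fun x => f x + g x).
Proof. by move=> fi gi; apply: eq_integrable (integrableD _ fi gi). Qed.

Lemma intZ (r : R) (f : R -> R) : int f -> int (fun x => r * f x).
Proof. by move=> fi; apply: eq_integrable (integrableZl _ r fi). Qed.

Lemma cintegrableD f g : cintegrable f -> cintegrable g ->
  cintegrable (fun x => f x + g x).
Proof.
move=> [f1 f2] [g1 g2]; split.
  by under eq_fun => x do rewrite ReD; exact: intD.
by under eq_fun => x do rewrite ImD; exact: intD.
Qed.

Lemma cintegralD f g : cintegrable f -> cintegrable g ->
  cintegral (fun x => f x + g x) = cintegral f + cintegral g.
Proof.
move=> [f1 f2] [g1 g2]; apply: complex_ext; rewrite ?ReD ?ImD /= /cintegral /=.
  by under eq_Rintegral => x _ do rewrite ReD; exact: RintegralD.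
by under eq_Rintegral => x _ do rewrite ImD; exact: RintegralD.
Qed.

Lemma cintegrableZ c f : cintegrable f -> cintegrable (fun x => c * f x).
Proof.
move=> [f1 f2]; split.
  under eq_fun => x do rewrite ReM -mulNr; exact: intD (intZ _ f1) (intZ _ f2).
by under eq_fun => x do rewrite ImM; exact: intD (intZ _ f2) (intZ _ f1).
Qed.

Lemma cintegralZ c f : cintegrable f ->
  cintegral (fun x => c * f x) = c * cintegral f.
Proof.
move=> [f1 f2]; apply: complex_ext; rewrite ?ReM ?ImM /= /cintegral /=.
  under eq_Rintegral => x _ do rewrite ReM.
  rewrite RintegralB // ?RintegralZl //; exact: intZ.
under eq_Rintegral => x _ do rewrite ImM.
rewrite RintegralD // ?RintegralZl //; exact: intZ.
Qed.

Lemma cintegrable0 : cintegrable (fun=> 0).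
Proof. by split; exact: integrable0. Qed.

Lemma cintegral0 : cintegral (fun=> 0 : C) = 0.
Proof.
have := cintegralZ 0 cintegrable0; under [X in cintegral X]eq_fun => x do rewrite mulr0.
by rewrite mul0r.
Qed.

Lemma cintegrable_sum (I : Type) (r : seq I) (F : I -> R -> C) :
  (forall i, cintegrable (F i)) -> cintegrable (fun x => \sum_(i <- r) F i x).
Proof.
move=> Fi; elim: r => [|i r IH].
  by under eq_fun => x do rewrite big_nil; exact: cintegrable0.
by under eq_fun => x do rewrite big_cons; exact: cintegrableD.
Qed.

Lemma cintegral_sum (I : Type) (r : seq I) (F : I -> R -> C) :
  (forall i, cintegrable (F i)) ->
  cintegral (fun x => \sum_(i <- r) F i x) = \sum_(i <- r) cintegral (F i).
Proof.
move=> Fi; elim: r => [|i r IH].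
  by under [X in cintegral X]eq_fun => x do rewrite big_nil; rewrite big_nil cintegral0.
under [X in cintegral X]eq_fun => x do rewrite big_cons.
by rewrite cintegralD ?IH ?big_cons //; exact: cintegrable_sum.
Qed.

Lemma cintegralJ f : cintegrable f ->
  cintegral (fun x => Num.conj (f x)) = Num.conj (cintegral f).
Proof.
move=> [f1 f2]; apply: complex_ext; rewrite ?ReJ ?ImJ /= /cintegral /=.
  by apply: eq_Rintegral => x _; rewrite ReJ.
under eq_Rintegral => x _ do rewrite ImJ -mulN1r.
by rewrite RintegralZl // mulN1r.
Qed.
End ComplexIntegral.

Lemma add_mxE (V : nmodType) m n (A B : 'M[V]_(m, n)) i j :
  (A + B) i j = A i j + B i j.
Proof. by rewrite mxE. Qed.

Lemma mul_mxE (R : pzSemiRingType) m n p (A : 'M[R]_(m, n)) (B : 'M[R]_(n, p)) i j :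
  (A *m B) i j = \sum_k A i k * B k j.
Proof. by rewrite mxE. Qed.

Section Positivity.
Local Open Scope complex_scope.
Local Open Scope sesquilinear_scope.
Variable R : realType.
Local Notation C := R[i].
Local Notation mu := (@lebesgue_measure R).

Lemma open_interval_inside (x0 x1 : \bar R) : (x0 < x1)%E ->
  exists a b : R, a < b /\ forall x, a < x < b -> in_itv_oo x0 x1 x.
Proof.
case: x0 x1 => [a| |] [b| |] //=.
- rewrite lte_fin => ab; exists a, b; split=> // x /andP[ax xb].
  by split; rewrite lte_fin.
- move=> _; exists a, (a + 1); split=> [|x /andP[ax _]]; first by rewrite ltrDl.
  by split; rewrite ?lte_fin ?ltry.
- move=> _; exists (b - 1), b; split=> [|x /andP[_ xb]].
    by rewrite ltrBlDr ltrDl.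
  by split; rewrite ?lte_fin ?ltNyr.
- by move=> _; exists 0, 1; split=> // x _; split; rewrite ?ltry ?ltNyr.
Qed.

Lemma finite_real_roots (p : {poly C}) : p != 0 ->
  finite_set [set x : R | root p x%:C].
Proof.
move=> p0; have [rs prs] := closed_field_poly_normal p.
apply: (@sub_finite_set _ _ [set` map (@complex.Re R) rs]); last exact: finite_seq.
move=> x /=; rewrite prs rootZ ?lead_coef_eq0 // root_prod_XsubC => xrs.
by apply/mapP; exists x%:C.
Qed.

(** If the integral were zero then [g] would vanish almost everywhere, but it is
    positive on an interval with finitely many points removed. *)
Lemma cintegral_gt0 (x0 x1 : \bar R) (g : R -> C) : (x0 < x1)%E ->
  cintegrable g -> (forall x, 0 <= g x) ->
  (exists2 p : {poly C}, p != 0 &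
     forall x, in_itv_oo x0 x1 x -> ~~ root p x%:C -> 0 < g x) ->
  0 < cintegral g.
Proof.
move=> x01 [gr _] g0 [p p0 gp].
have gRe x : 0 <= complex.Re (g x) by have := g0 x; rewrite lecE => /andP[].
rewrite ltcE; apply/andP; split.
  rewrite /=; have gIm x : complex.Im (g x) = 0.
    by have := g0 x; rewrite lecE => /andP[/eqP].
  under eq_Rintegral => x _ do rewrite gIm.
  by rewrite Rintegral_cst // mul0r.
rewrite /= lt_neqAle Rintegral_ge0 // andbT; apply/negP => /eqP int0.
have [a [b [ab abI]]] := open_interval_inside x01.
pose Z := [set x : R | root p x%:C]%classic.
have rts : finite_set Z := finite_real_roots p0.
have ae0 : ae_eq mu setT (fun x : measurableTypeR R => (complex.Re (g x))%:E) (cst 0%E).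
  apply/ae_eq_integral_abs => //; first exact: measurable_int gr.
  rewrite (eq_integral (fun x : measurableTypeR R => (complex.Re (g x))%:E));
    last by move=> x _; rewrite gee0_abs // lee_fin.
  rewrite -[LHS]fineK; last exact: integrable_fin_num.
  by rewrite -[X in X%:E]/(Rintegral _ _ _) -int0.
have Zneg : mu.-negligible Z.
  have cZ := finite_set_countable rts.
  apply/negligibleP; last exact: countable_lebesgue_measure0.
  by apply: countable_measurable cZ => t; exact: measurable_set1.
have : mu.-negligible `]a, b[%classic.
  apply: negligibleS (negligibleU ae0 Zneg) => x /= xab.
  have [xZ|xZ] := pselect (Z x); [by right | left => gx].
  have /(gp _ (abI _ _)) : ~~ root p x%:C by exact/negP.
  move: xab; rewrite in_itv /= => xab /(_ xab).
  by rewrite ltcE /= => /andP[_]; have := gx I => -[->]; rewrite ltxx.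
move/negligibleP => /(_ (measurable_itv _)) mu0.
have := etrans (esym mu0) (lebesgue_measure_itv `]a, b[).
rewrite /= lte_fin ab -EFinB => /eqP; rewrite eqe eq_sym subr_eq0.
by rewrite gt_eqF.
Qed.
End Positivity.

Section WeightForm.
Local Open Scope complex_scope.
Local Open Scope sesquilinear_scope.
Variables (R : realType) (n : nat) (x0 x1 : \bar R) (W : R -> 'M[R[i]]_n.+1).
Hypothesis hW : weight_matrix x0 x1 W.
Local Notation C := R[i].
Local Notation M := 'M[{poly C}]_n.+1.
Local Notation mu := (@lebesgue_measure R).
Implicit Types (F G : M).

Lemma cintegrable_moment k i j : cintegrable (fun x : R => (x%:C ^+ k * W x i j : C)).
Proof.
have xkR (x : R) : complex.Re (x%:C ^+ k) = x ^+ k /\ complex.Im (x%:C ^+ k) = 0.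
  by rewrite -rmorphXn.
have [Wr Wi] := weight_moments hW i j; split.
  apply: eq_integrable (Wr k) => // x _ /=.
  by rewrite ReM (xkR x).1 (xkR x).2 mul0r subr0.
apply: eq_integrable (Wi k) => // x _ /=.
by rewrite ImM (xkR x).1 (xkR x).2 mul0r addr0.
Qed.

Lemma cintegrable_poly (p : {poly C}) i j :
  cintegrable (fun x : R => p.[x%:C] * W x i j).
Proof.
under eq_fun => x do rewrite horner_coef mulr_suml.
apply: cintegrable_sum => k; under eq_fun => x do rewrite -mulrA.
exact/cintegrableZ/cintegrable_moment.
Qed.

Lemma conj_real (x : R) : Num.conj (x%:C : C) = x%:C.
Proof. exact: conjc_real. Qed.

Lemma conj_horner (p : {poly C}) (x : R) :
  Num.conj p.[x%:C] = (map_poly Num.conj p).[x%:C].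
Proof. by rewrite -[in RHS](conj_real x) horner_map. Qed.

Definition integrand F G i j (x : R) : C :=
  (evalmx F x *m W x *m (evalmx G x)^t*) i j.

Lemma cintegrable_integrand F G i j : cintegrable (integrand F G i j).
Proof.
rewrite /integrand; under eq_fun => x do rewrite mxE.
apply: cintegrable_sum => l; under eq_fun => x do rewrite mxE mulr_suml.
apply: cintegrable_sum => k.
pose p := F i k * map_poly Num.conj (G j l).
rewrite [X in cintegrable X](_ : _ = fun x : R => p.[x%:C] * W x k l).
  exact: cintegrable_poly.
apply/funext => x.
by rewrite !mxE /p hornerM -conj_horner mulrAC.
Qed.

Lemma evalmxD F G x : evalmx (F + G) x = evalmx F x + evalmx G x.
Proof. by apply/matrixP => i j; rewrite !mxE hornerD. Qed.

Lemma evalmx_mulC c F x : evalmx (map_mx polyC c *m F) x = c *m evalmx F x.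
Proof.
apply/matrixP => i j; rewrite !mxE horner_sum; apply: eq_bigr => k _.
by rewrite !mxE hornerM hornerC.
Qed.

Lemma evalmxX F x : evalmx ('X *: F) x = x%:C *: evalmx F x.
Proof. by apply/matrixP => i j; rewrite !mxE hornerM hornerX. Qed.

Lemma weight_adj x : (W x)^t* = W x.
Proof. by have /is_hermitianmxP := weight_hermitian hW x; rewrite expr0 scale1r. Qed.

(** Definiteness: the row of polynomials [u F] has a nonzero entry, so that it
    vanishes at finitely many points only, and elsewhere in the interval the
    integrand of the quadratic form is positive because the weight is. *)
Lemma integral_inner_product (ip : M -> M -> 'M[C]_n.+1) :
  (forall F G i j, ip F G i j = cintegral (integrand F G i j)) ->
  polynomial_inner_product ip.
Proof.
move=> ipE; split.
- move=> F G H; apply/matrixP => i j; rewrite mxE !ipE -cintegralD;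
    try exact: cintegrable_integrand.
  congr cintegral; apply/funext => x.
  by rewrite /integrand evalmxD !mulmxDl add_mxE.
- move=> c F G; apply/matrixP => i j; rewrite mxE ipE.
  rewrite (eq_bigr (fun k => cintegral (fun x => c i k * integrand F G k j x)));
    last by move=> k _; rewrite ipE cintegralZ //; exact: cintegrable_integrand.
  rewrite -cintegral_sum => [|k]; last exact/cintegrableZ/cintegrable_integrand.
  congr cintegral; apply/funext => x; rewrite /integrand evalmx_mulC -!mulmxA mul_mxE.
  apply: eq_bigr => k _. by rewrite !mulmxA.
- move=> F G; apply/matrixP => i j; rewrite !ipE.
  congr cintegral; apply/funext => x; rewrite /integrand !evalmxX.
  by rewrite adjmxZ conj_real -!scalemxAl -scalemxAr.
- move=> F G; apply/matrixP => i j; rewrite adjmxE !ipE.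
  rewrite -cintegralJ; last exact: cintegrable_integrand.
  congr cintegral; apply/funext => x.
  by rewrite /integrand -[RHS]adjmxE !adjmxM adjmxK weight_adj mulmxA.
move=> F u uF.
pose g x : C := (u *m evalmx F x *m W x *m (u *m evalmx F x)^t*) 0 0.
have gE x : g x = \sum_l Num.conj (u 0 l) * \sum_k u 0 k * integrand F F k l x.
  have -> : g x = (u *m (evalmx F x *m W x *m (evalmx F x)^t*) *m u^t*) 0 0.
    by rewrite /g adjmxM !mulmxA.
  rewrite mul_mxE; apply: eq_bigr => l _.
  by rewrite adjmxE mulrC mul_mxE.
have gki k l : cintegrable (fun x => u 0 k * integrand F F k l x).
  exact/cintegrableZ/cintegrable_integrand.
have gli l : cintegrable
    (fun x => Num.conj (u 0 l) * \sum_k u 0 k * integrand F F k l x).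
  exact/cintegrableZ/cintegrable_sum.
have gi : cintegrable g by rewrite (funext gE); exact: cintegrable_sum.
have -> : (u *m ip F F *m u^t*) 0 0 = cintegral g.
  rewrite (funext gE) cintegral_sum // mul_mxE; apply: eq_bigr => l _.
  rewrite adjmxE mulrC cintegralZ ?cintegral_sum // ?mul_mxE; last first.
    exact: cintegrable_sum.
  congr (_ * _); apply: eq_bigr => k _; rewrite ipE cintegralZ //.
  exact: cintegrable_integrand.
have uFE x j : (u *m evalmx F x) 0 j = ((map_mx polyC u *m F) 0 j).[x%:C].
  rewrite !mul_mxE horner_sum; apply: eq_bigr => k _.
  by rewrite !mxE hornerM hornerC.
have g_gt0 x : in_itv_oo x0 x1 x -> u *m evalmx F x != 0 -> 0 < g x.
  move=> xi v0; exact: (weight_posdef hW xi v0).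
have g_ge0 x : 0 <= g x.
  have [xi|xo] := pselect (in_itv_oo x0 x1 x); last first.
    by rewrite /g (weight_out hW xo) mulmx0 mul0mx mxE.
  have [v0|] := eqVneq (u *m evalmx F x) 0; last by move=> /(g_gt0 _ xi)/ltW.
  by rewrite /g v0 !mul0mx mxE.
have [j pj] : exists j, (map_mx polyC u *m F) 0 j != 0.
  apply: contrapT => /forallNP uF0; move/eqP: uF; apply; apply/matrixP => i j.
  by rewrite ord1 [RHS]mxE; apply/eqP/negPn/negP/uF0.
apply: (cintegral_gt0 (weight_itv hW) gi g_ge0).
exists ((map_mx polyC u *m F) 0 j) => //.
move=> x xi nr; apply: g_gt0 => //; apply: contraNneq nr => v0.
by apply/rootP; rewrite -uFE v0 mxE.
Qed.
Lemma weight_inner_product : polynomial_inner_product (inner W).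
Proof. by apply: integral_inner_product => F G i j; rewrite mxE. Qed.
End WeightForm.

Theorem theorem4p21 (R : realType) (x0 x1 : \bar R) (W : R -> 'M[R[i]]_2)
    (hW : weight_matrix x0 x1 W)
    (hnc : exists D E : bispectral_algebra W, D * E <> E * D) :
  full (bispectral_algebra W) 2 /\
  is_field (total_fractions (ring_center (bispectral_algebra W))) /\
  exists phi : {rmorphism central_loc (bispectral_algebra W) ->
                 'M[total_fractions (ring_center (bispectral_algebra W))]_2},
    [/\ bijective phi,
        forall x : total_fractions (ring_center (bispectral_algebra W)),
          phi (tens _ 1 x) = x%:M,
        injective (fun D : bispectral_algebra W => phi (tens _ D 1))
      & is_order (to_loc (@nonzerodiv (ring_center (bispectral_algebra W))))
          [set phi (tens _ D 1) | D in [set: bispectral_algebra W]]].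
Proof.
exact: (bispectral_algebra_structure (weight_inner_product hW) hnc).
Qed.
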